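(* Suppose $n$ is an even integer with $t_1+t_2\leq n<t_3$, and put $K=k_1+k_2+k_3$, $N=\tfrac{n+1}{2}$. Then: (i) the $\mathfrak{BI}$-module $\mathscr M_n(x_1)\cap\mathscr M_n(x_2)$ is isomorphic to $W_1\oplus W_1$, where $W_1=O_{n-t_1-t_2}(k_2+k_3+N,\,-k_1-k_3-N,\,-N)^{((-1,1),(1\,2))}$; (ii) the $\mathfrak{BI}$-modules $\mathscr M_n(x_2)/(\mathscr M_n(x_1)\cap\mathscr M_n(x_2))$ and $\mathscr M_n/\mathscr M_n(x_1)$ are each isomorphic to $W_2\oplus W_2$, where $W_2=O_{t_1-1}(k_3,\,-K-n-1,\,-k_2)^{((1,-1),(1\,2))}$; (iii) the $\mathfrak{BI}$-modules $\mathscr M_n(x_1)/(\mathscr M_n(x_1)\cap\mathscr M_n(x_2))$ and $\mathscr M_n/\mathscr M_n(x_2)$ are each isomorphic to $W_3\oplus W_3$, where $W_3=O_{t_2-1}(k_3,\,-K-n-1,\,-k_1)^{(1,-1)}$. Moreover, if $k_3\geq0$, then $W_1,W_2,W_3$ are irreducible and are isomorphic to $O_{n-t_1-t_2}(-k_1-k_3-N,\,-k_2-k_3-N,\,N)$, $O_{t_1-1}(K+n+1,\,k_3,\,k_2)$ and $O_{t_2-1}(k_3,\,K+n+1,\,k_1)$, respectively.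
   Context: Fix real numbers $k_1,k_2,k_3$. For $i=1,2,3$ let $R_i$ be the operator on functions on $\mathbb R^3$ replacing $x_i$ by $-x_i$, and $T_if=\frac{\partial f}{\partial x_i}+k_i\frac{f-R_if}{x_i}$ (Dunkl operators). Let $\sigma_1=\begin{pmatrix}0&1\\1&0\end{pmatrix}$, $\sigma_2=\begin{pmatrix}0&-\sqrt{-1}\\ \sqrt{-1}&0\end{pmatrix}$, $\sigma_3=\begin{pmatrix}1&0\\0&-1\end{pmatrix}$, and let $e_i$ act on $\mathbb C^2$ by $\sigma_i$. Tensor products are over $\mathbb R$; $\mathbb R[\cdots]_m$ denotes homogeneous polynomials of degree $m$. Let $\mathbf D=e_1\otimes T_1+e_2\otimes T_2+e_3\otimes T_3$ and $\mathscr M_n=\ker(\mathbf D|_{\mathbb C^2\otimes\mathbb R[x_1,x_2,x_3]_n})$. For $i=1,2,3$ set $t_i=-2k_i$ if $2k_i$ is an odd negative integer, and $t_i=\infty$ otherwise. For $i=1,2,3$, $\mathscr M_n(x_i)=\mathscr M_n\cap\bigoplus_{j=t_i}^n\mathbb C^2\otimes(x_i^j\cdot\mathbb R[x_p,x_q]_{n-j})$ where $\{p,q\}=\{1,2,3\}\setminus\{i\}$ (it is $\{0\}$ if $n<t_i$); it is a $\mathfrak{BI}$-submodule of $\mathscr M_n$. $\mathfrak{BI}$ is the unital associative $\mathbb C$-algebra generated by $X,Y,Z$ with relations saying that $\{X,Y\}-Z$, $\{Y,Z\}-X$, $\{Z,X\}-Y$ commute with $X,Y,Z$ ($\{A,B\}=AB+BA$).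 $\mathscr M_n$ is a $\mathfrak{BI}$-module via $X=(\sqrt{-1}\,e_1\otimes(x_3T_2-x_2T_3)+\tfrac12)R_2R_3+k_2R_3+k_3R_2$, $Y=(\sqrt{-1}\,e_2\otimes(x_1T_3-x_3T_1)+\tfrac12)R_1R_3+k_3R_1+k_1R_3$, $Z=(\sqrt{-1}\,e_3\otimes(x_2T_1-x_1T_2)+\tfrac12)R_1R_2+k_1R_2+k_2R_1$, operators composed right to left, $R_i$ acting on the polynomial factor. Twisting: for a $\mathfrak{BI}$-module $V$ and algebra automorphism $\varepsilon$, $V^\varepsilon$ is $V$ with action $x\cdot v=\varepsilon(x)v$. A permutation $\sigma\in\mathfrak S_3$ denotes the automorphism sending the generator with index $i$ in $(X,Y,Z)$ to the generator with index $\sigma(i)$; the sign automorphisms are $(1,-1)\colon X\mapsto X,Y\mapsto -Y,Z\mapsto -Z$; $(-1,1)\colon X\mapsto -X,Y\mapsto Y,Z\mapsto -Z$; $(-1,-1)\colon X\mapsto -X,Y\mapsto -Y,Z\mapsto Z$; a pair $(\epsilon,\sigma)$ denotes the composite $\epsilon\circ\sigma$. For $a,b,c\in\mathbb C$ and even $d\geq0$, $O_d(a,b,c)$ is the $\mathfrak{BI}$-module $\mathbb C^{d+1}$ in which, w.r.t. a basis $v_0,\dots,v_d$, $X$ acts by the lower bidiagonal matrix with diagonal $(\theta_0,\dots,\theta_d)$ and subdiagonal entries $1$, $Y$ by the upper bidiagonal matrix with diagonal $(\theta^*_0,\dots,\theta^*_d)$ and superdiagonal $(\varphi_1,\dots,\varphi_d)$,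 and $Z=\{X,Y\}-(2ab-c(d+1))$, where $\theta_i=\frac{(-1)^i(2a-d+2i)}{2}$, $\theta^*_i=\frac{(-1)^i(2b-d+2i)}{2}$, $\varphi_i=\frac{i(d+1-2i-2a-2b-2c)}{2}$ ($i$ even), $\varphi_i=\frac{(i-d-1)(d+1-2i-2a-2b+2c)}{2}$ ($i$ odd). *)

(* Defs.v *)
From HB Require Import structures.
From mathcomp Require Import all_boot all_order all_fingroup all_algebra.
From mathcomp Require Import reals.
From mathcomp.real_closed Require Import complex.
From mathcomp.multinomials Require Import mpoly.
From Stdlib Require Import ClassicalEpsilon.

Set Implicit Arguments.
Unset Strict Implicit.
Unset Printing Implicit Defensive.

Import GRing.Theory Num.Theory.
Local Open Scope ring_scope.

Definition i1 : 'I_3 := @Ordinal 3 0 isT.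
Definition i2 : 'I_3 := @Ordinal 3 1 isT.
Definition i3 : 'I_3 := @Ordinal 3 2 isT.

Section Defs.
Variable R : realType.

Local Notation C := (R[i]).
Definition cR (x : R) : C := real_complex R x.
Definition iC : C := Complex 0 1.

Local Notation Pol := ({mpoly C[3]}).
(* C^2 (x)_R R[x_1,x_2,x_3], realised as pairs of complex polynomials
   (coordinates w.r.t. the standard basis of C^2). *)
Definition V := (Pol * Pol)%type.

Definition refl (i : 'I_3) (p : Pol) : Pol :=
  p \mPo [tuple (if j == i then - 'X_j else 'X_j) | j < 3].

(* division by x_i of a polynomial (exact when x_i divides it):
   x_i^a * rest |-> x_i^(a-1) * rest, on monomials with a > 0 *)
Definition divX (i : 'I_3) (p : Pol) : Pol :=
  \sum_(m <- msupp p | (0 < m i)%N) p@_m *: 'X_[(m - U_(i))%MM].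

Definition kof (k1 k2 k3 : R) (i : 'I_3) : R :=
  if val i == 0%N then k1 else if val i == 1%N then k2 else k3.

Definition dunkl (k1 k2 k3 : R) (i : 'I_3) (p : Pol) : Pol :=
  mderiv i p + cR (kof k1 k2 k3 i) *: divX i (p - refl i p).

Definition vmap (L : Pol -> Pol) (v : V) : V := (L v.1, L v.2).

(* e_i acting by the Pauli matrix sigma_i on C^2 *)
Definition sig (i : 'I_3) (v : V) : V :=
  if val i == 0%N then (v.2, v.1)
  else if val i == 1%N then (- (iC *: v.2), iC *: v.1)
  else (v.1, - v.2).

Definition Dirac (k1 k2 k3 : R) (v : V) : V :=
  sig i1 (vmap (dunkl k1 k2 k3 i1) v) + sig i2 (vmap (dunkl k1 k2 k3 i2) v)
  + sig i3 (vmap (dunkl k1 k2 k3 i3) v).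

Definition Mn (k1 k2 k3 : R) (n : nat) (v : V) : Prop :=
  [/\ v.1 \is n.-homog, v.2 \is n.-homog & Dirac k1 k2 k3 v = 0].

(* t_i = -2k_i if 2k_i is an odd negative integer, infinity (None) otherwise *)
Definition tfun (k : R) : option nat :=
  match excluded_middle_informative
          (exists m : nat, odd m /\ 2 * k = - (m%:R)) with
  | left H => Some (proj1_sig (constructive_indefinite_description _ H))
  | right _ => None
  end.

(* M_n(x_i) = M_n \cap \bigoplus_{j = t_i}^n C^2 (x) x_i^j R[x_p,x_q]_{n-j}
   ({0} when t_i = infinity) *)
Definition Mnx (k1 k2 k3 : R) (n : nat) (i : 'I_3) (v : V) : Prop :=
  Mn k1 k2 k3 n v /\
  match tfun (kof k1 k2 k3 i) with
  | None => v = 0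
  | Some t => forall m, (m \in msupp v.1) || (m \in msupp v.2) -> (t <= m i)%N
  end.

Definition genX (k1 k2 k3 : R) (v : V) : V :=
  let w := vmap (refl i2 \o refl i3) v in
  iC *: sig i1 (vmap (fun f => 'X_i3 * dunkl k1 k2 k3 i2 f
                              - 'X_i2 * dunkl k1 k2 k3 i3 f) w)
  + (2 : C)^-1 *: w
  + cR k2 *: vmap (refl i3) v + cR k3 *: vmap (refl i2) v.

Definition genY (k1 k2 k3 : R) (v : V) : V :=
  let w := vmap (refl i1 \o refl i3) v in
  iC *: sig i2 (vmap (fun f => 'X_i1 * dunkl k1 k2 k3 i3 f
                              - 'X_i3 * dunkl k1 k2 k3 i1 f) w)
  + (2 : C)^-1 *: w
  + cR k3 *: vmap (refl i1) v + cR k1 *: vmap (refl i3) v.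

Definition genZ (k1 k2 k3 : R) (v : V) : V :=
  let w := vmap (refl i1 \o refl i2) v in
  iC *: sig i3 (vmap (fun f => 'X_i2 * dunkl k1 k2 k3 i1 f
                              - 'X_i1 * dunkl k1 k2 k3 i2 f) w)
  + (2 : C)^-1 *: w
  + cR k1 *: vmap (refl i2) v + cR k2 *: vmap (refl i1) v.

Definition BIact (k1 k2 k3 : R) (g : 'I_3) : V -> V :=
  if val g == 0%N then genX k1 k2 k3
  else if val g == 1%N then genY k1 k2 k3 else genZ k1 k2 k3.

(* A finite-dimensional BI-module C^m given by the matrices of X, Y, Z
   (index 0, 1, 2) acting on column vectors. *)
Definition bimod (m : nat) := 'I_3 -> matrix C m m.

Definition Otheta (a : C) (d i : nat) : C :=
  (-1) ^+ i * (2 * a - d%:R + 2 * i%:R) / 2.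
Definition Ophi (a b c : C) (d i : nat) : C :=
  if ~~ odd i then i%:R * (d.+1%:R - 2 * i%:R - 2 * a - 2 * b - 2 * c) / 2
  else (i%:R - d.+1%:R) * (d.+1%:R - 2 * i%:R - 2 * a - 2 * b + 2 * c) / 2.
Definition OX (a : C) (d : nat) : matrix C d.+1 d.+1 :=
  \matrix_(i, j) (if i == j then Otheta a d i
                  else if val i == (val j).+1 then 1 else 0).
Definition OY (a b c : C) (d : nat) : matrix C d.+1 d.+1 :=
  \matrix_(i, j) (if i == j then Otheta b d i
                  else if val j == (val i).+1 then Ophi a b c d j else 0).
Definition Omod (d : nat) (a b c : C) : bimod d.+1 := fun g =>
  if val g == 0%N then OX a d
  else if val g == 1%N then OY a b c d
  else OX a d *m OY a b c d + OY a b c d *m OX a d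
       - (2 * a * b - c * d.+1%:R)%:M.

Definition dsum m1 m2 (M1 : bimod m1) (M2 : bimod m2) : bimod (m1 + m2) :=
  fun g => block_mx (M1 g) 0 0 (M2 g).

(* twist V^eps by eps = (e1,e2) o s : generator g |-> sign(s g) * generator (s g),
   where the sign automorphism (e1,e2) is X |-> e1 X, Y |-> e2 Y, Z |-> e1 e2 Z *)
Definition sgnaut (e1 e2 : C) (g : 'I_3) : C :=
  if val g == 0%N then e1 else if val g == 1%N then e2 else e1 * e2.
Definition twist m (e1 e2 : C) (s : 'S_3) (M : bimod m) : bimod m :=
  fun g => sgnaut e1 e2 (s g) *: M (s g).

(* The subquotient B/A of V (A a submodule of the submodule B) is isomorphic
   to the matrix module W: there is a C-linear map B -> C^m, surjective,
   with kernel A, intertwining the action of the generators. *)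
Definition subquot_iso (Xs : 'I_3 -> V -> V) (B A : V -> Prop)
    m (W : bimod m) : Prop :=
  exists phi : V -> matrix C m 1,
    [/\ forall (a : C) u v, B u -> B v -> phi (a *: u + v) = a *: phi u + phi v,
        forall v, B v -> (phi v = 0 <-> A v),
        forall w, exists2 v, B v & phi v = w
      & forall g v, B v -> phi (Xs g v) = W g *m phi v].

Definition mx_iso m (W1 W2 : bimod m) : Prop :=
  exists P : matrix C m m, P \in unitmx /\ forall g, P *m W1 g = W2 g *m P.

(* irreducibility: nonzero, and the only invariant subspaces are 0 and C^m.
   A subspace of column vectors is encoded by the row space of U (rows = transposed vectors). *)
Definition irreducible m (W : bimod m) : Prop :=
  (0 < m)%N /\
  forall U : matrix C m m, (forall g, (U *m (W g)^T <= U)%MS) ->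
    (U == (0 : matrix C m m))%MS \/ row_full U.

End Defs.

(* Main.v *)
(** An element [f] of [M_n] is determined by its restriction to [x_3 = 0]: the
    coefficients of [T_3 x_3^j] are nonzero for [1 <= j <= n] because [n < t_3], so
    the Dirac equation gives the part of [x_3]-degree [j + 1] of [f] from the part of
    degree [j] (Cauchy-Kovalevskaya extension), and the restriction is arbitrary.
    In the coordinates given by the monomials [x_1^a x_2^(n-a)], the generators
    preserve the two components of [C^2], [X] and [Y] are bidiagonal on opposite
    sides of the diagonal, and [M_n(x_1)], [M_n(x_2)] are the subspaces [a >= t_1] and
    [n - a >= t_2].  Rescaling the monomials gives the two copies of each [O_d].

    For the last part, an explicit polynomial in [X] applied to the last basis vector
    intertwines [O_d(a,b,c)] with a twist of [O_d(-b,a,-c)] as soon as the [phi_i] of the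
    latter do not vanish.  If the [phi_i] of both modules are nonzero, then both are
    irreducible: a nonzero submodule contains a vector with nonzero last coordinate,
    hence the image of the last basis vector of the first module, which generates. *)
Require Import Defs.
From HB Require Import structures.
From mathcomp Require Import all_boot all_order all_fingroup all_algebra.
From mathcomp Require Import reals.
From mathcomp.real_closed Require Import complex.
From mathcomp.multinomials Require Import mpoly.
From mathcomp Require Import ring zify.
From Stdlib Require Import ClassicalEpsilon.
Import GRing.Theory Num.Theory.
Local Open Scope ring_scope.

Set Implicit Arguments.
Unset Strict Implicit.
Unset Printing Implicit Defensive.

(** * Bidiagonal modules *)

Lemma signr_cases (K : pzRingType) (i : nat) :
  odd i = true /\ (-1) ^+ i = -1 :> K \/ odd i = false /\ (-1) ^+ i = 1 :> K.
Proof. by rewrite -signr_odd; case: (odd i); [left|right]. Qed.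

Section BidiagonalModules.
Variable R : realType.
Local Notation C := (R[i]).

(** The value 0 below index 0 gives the first row of a lower bidiagonal matrix the same formula as
    the other rows. *)
Definition prv (y : nat -> C) (i : nat) : C := if i is j.+1 then y j else 0.

(** Coordinates are functions on all of [nat], so that index shifts carry no bounds; values beyond
    [d] are ignored. *)
Definition cvec d (y : nat -> C) : 'cV[C]_d.+1 := \col_i y i.

Lemma eq_cvec d (y z : nat -> C) :
  (forall i, (i <= d)%N -> y i = z i) -> cvec d y = cvec d z.
Proof. by move=> e; apply/colP=> i; rewrite !mxE e // -ltnS ltn_ord. Qed.

Lemma cvec_surj d (w : 'cV[C]_d.+1) : w = cvec d (fun i => w (inord i) 0).
Proof. by apply/colP=> i; rewrite mxE inord_val. Qed.

Lemma cvecZ d x y : x *: cvec d y = cvec d (fun i => x * y i).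
Proof. by apply/colP=> i; rewrite !mxE. Qed.

Lemma cvecD d y z : cvec d y + cvec d z = cvec d (fun i => y i + z i).
Proof. by apply/colP=> i; rewrite !mxE. Qed.

Lemma cvecB d y z : cvec d y - cvec d z = cvec d (fun i => y i - z i).
Proof. by apply/colP=> i; rewrite !mxE. Qed.

Lemma OX_cvec (a : C) d y :
  OX a d *m cvec d y = cvec d (fun i => Otheta a d i * y i + prv y i).
Proof.
apply/colP=> i; rewrite !mxE (bigD1 i) //= !mxE eqxx; congr (_ + _).
case: i => [[|k] ltk] /=.
  by apply: big1 => j; rewrite !mxE eq_sym => /negbTE -> /=; rewrite mul0r.
rewrite (bigD1 (Ordinal (ltnW ltk))) /=; last by rewrite -val_eqE /= neq_ltn ltnSn.
rewrite !mxE -val_eqE /= eqxx gtn_eqF // mul1r big1 ?addr0 // => j /andP[nj nk].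
rewrite !mxE eq_sym (negbTE nj) /= eqSS.
by move: nk; rewrite -val_eqE /= eq_sym => /negbTE ->; rewrite mul0r.
Qed.

(** The factor $i-d-1$ of $\varphi_i$ for odd $i$ vanishes at $i=d+1$. This erases the out-of-range
    coordinate $y_{d+1}$ in the last row of [OY_cvec]. *)
Lemma Ophi_max (a b c : C) d : ~~ odd d -> Ophi a b c d d.+1 = 0.
Proof. by move=> d_even; rewrite /Ophi /= d_even /= subrr !mul0r. Qed.

Lemma Ophi0 (a b c : C) d : Ophi a b c d 0 = 0.
Proof. by rewrite /Ophi /= !mul0r. Qed.

Lemma OY_cvec (a b c : C) d y : ~~ odd d ->
  OY a b c d *m cvec d y
  = cvec d (fun i => Otheta b d i * y i + Ophi a b c d i.+1 * y i.+1).
Proof.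
move=> d_even; apply/colP=> i; rewrite !mxE (bigD1 i) //= !mxE eqxx; congr (_ + _).
have [ltid|] := ltnP i d.
  rewrite (bigD1 (Ordinal (ltid : (i.+1 < d.+1)%N))) /=; last first.
    by rewrite -val_eqE /= neq_ltn ltnSn orbT.
  rewrite !mxE -val_eqE /= eqxx ltn_eqF // big1 ?addr0 // => j /andP[nj nk].
  rewrite !mxE eq_sym (negbTE nj).
  by move: nk; rewrite -val_eqE /= => /negbTE ->; rewrite mul0r.
move=> ledi; have -> : i = d :> nat by have := ltn_ord i; lia.
rewrite Ophi_max // mul0r big1 // => j nj.
rewrite !mxE eq_sym (negbTE nj) ltn_eqF ?mul0r //.
by have := (ltn_ord j, ltn_ord i) => -[/= hj hi]; lia.
Qed.

Definition Ozeta (c : C) (d i : nat) : C :=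
  (-1) ^+ i * (d%:R / 2 + c + 1 / 2) - 1 / 2.

(** Off the diagonal, $XY+YX$ carries the sums
    $\theta_{i-1}+\theta_i=\theta^*_{i-1}+\theta^*_i=(-1)^i$, so $Z$ is tridiagonal; its diagonal is
    [Ozeta]. *)
Lemma OZ_cvec (a b c : C) d y : ~~ odd d ->
  Omod d a b c i3 *m cvec d y
  = cvec d (fun i => Ozeta c d i * y i + (-1) ^+ i * prv y i
                     - (-1) ^+ i * Ophi a b c d i.+1 * y i.+1).
Proof.
move=> d_even; rewrite /Omod /= mulmxBl mulmxDl -!mulmxA mul_scalar_mx.
rewrite !(OX_cvec, OY_cvec) // cvecZ !(cvecD, cvecB).
apply: eq_cvec => i _; rewrite /prv /Ozeta /Otheta /Ophi.
case: i => [|i] /=.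
  by rewrite expr0 ?expr1 /=; field.
rewrite !exprS.
by case: (signr_cases C i) => -[-> ->] /=; field.
Qed.

Lemma mx_cvecP d m (A B : 'M[C]_(m, d.+1)) :
  (forall y, A *m cvec d y = B *m cvec d y) -> A = B.
Proof.
move=> e; apply/trmx_inj/row_matrixP=> j; rewrite -!tr_col !colE; congr (_^T).
suff -> : delta_mx j 0 = cvec d (fun k => (k == j)%:R) :> 'cV[C]_d.+1 by apply: e.
by apply/colP=> k; rewrite !mxE eqxx andbT.
Qed.

(** Together with the definition of $Z$, this and the next lemma give the defining relations on
    $O_d$, the central elements acting by scalars. They feed the recursion for the defect of
    [flip_mx]. *)
Lemma O_anticomm_XZ (a b c : C) d : ~~ odd d ->
  OX a d *m Omod d a b c i3 + Omod d a b c i3 *m OX a d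
  = OY a b c d + (2 * a * c - b * d.+1%:R)%:M.
Proof.
move=> d_even; have := OZ_cvec a b c (d := d); move: (Omod d a b c i3) => OZ hZ.
apply: mx_cvecP => y; rewrite !mulmxDl -!mulmxA mul_scalar_mx.
rewrite !(OX_cvec, OY_cvec, hZ) // cvecZ !(cvecD, cvecB).
apply: eq_cvec => i _; rewrite /prv /Ozeta /Otheta /Ophi.
case: i => [|[|i]] /=.
- by rewrite expr0 ?expr1 /=; field.
- by rewrite !expr1 expr2 /=; field.
rewrite !exprS.
by case: (signr_cases C i) => -[-> ->] /=; field.
Qed.

Lemma O_anticomm_YZ (a b c : C) d : ~~ odd d ->
  OY a b c d *m Omod d a b c i3 + Omod d a b c i3 *m OY a b c d
  = OX a d + (2 * b * c - a * d.+1%:R)%:M.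
Proof.
move=> d_even; have := OZ_cvec a b c (d := d); move: (Omod d a b c i3) => OZ hZ.
apply: mx_cvecP => y; rewrite !mulmxDl -!mulmxA mul_scalar_mx.
rewrite !(OX_cvec, OY_cvec, hZ) // cvecZ !(cvecD, cvecB).
apply: eq_cvec => i _; rewrite /prv /Ozeta /Otheta /Ophi.
case: i => [|i] /=.
  by rewrite expr0 ?expr1 /=; field.
rewrite !exprS.
by case: (signr_cases C i) => -[-> ->] /=; field.
Qed.

(** Indexing by [nat] makes the vector 0 beyond index [d], so that $Xv_d=\theta_dv_d$ is an instance
    of [OX_evec]. *)
Definition evec d (i : nat) : 'cV[C]_d.+1 := cvec d (fun r => (r == i)%:R).

Lemma evec_out d i : (d < i)%N -> evec d i = 0.
Proof.
move=> ltdi; apply/colP=> r; rewrite !mxE ltn_eqF //.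
by apply: leq_trans (ltn_ord r) ltdi.
Qed.

Lemma mx_evecP d m (A B : 'M[C]_(m, d.+1)) :
  (forall i, (i <= d)%N -> A *m evec d i = B *m evec d i) -> A = B.
Proof.
move=> e; apply/trmx_inj/row_matrixP=> j; rewrite -!tr_col !colE; congr (_^T).
suff -> : delta_mx j 0 = evec d j :> 'cV[C]_d.+1 by apply: e; rewrite -ltnS.
by apply/colP=> k; rewrite !mxE eqxx andbT.
Qed.

Lemma OX_evec (a : C) d i :
  OX a d *m evec d i = Otheta a d i *: evec d i + evec d i.+1.
Proof.
rewrite /evec OX_cvec cvecZ cvecD; apply: eq_cvec => r _.
have -> : prv (fun r => (r == i)%:R) r = (r == i.+1)%:R by case: r.
by case: eqP => [->|] //=; rewrite !mulr0.
Qed.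

(** For $i=0$ the index [i.-1] is again 0, but its coefficient $\varphi_0$ is 0. *)
Lemma OY_evec (a b c : C) d i : ~~ odd d ->
  OY a b c d *m evec d i
  = Otheta b d i *: evec d i + Ophi a b c d i *: evec d i.-1.
Proof.
move=> d_even; rewrite /evec OY_cvec // !cvecZ cvecD; apply: eq_cvec => r _.
congr (_ + _); first by case: eqP => [->|] //=; rewrite !mulr0.
case: i => [|i] /=; first by rewrite Ophi0 mul0r mulr0.
by rewrite eqSS; case: eqP => [->|] //=; rewrite !mulr0.
Qed.

Lemma cvec_sum d y : cvec d y = \sum_(i < d.+1) y i *: evec d i.
Proof.
apply/colP=> r; rewrite summxE (bigD1 r) //= !mxE eqxx mulr1 big1 ?addr0 // => j nj.
by rewrite !mxE (inj_eq val_inj) eq_sym (negbTE nj) mulr0.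
Qed.

(** The empty predicate is allowed, hence the witness asked for by [subspace0]. *)
Definition subspace m (P : 'cV[C]_m -> Prop) : Prop :=
  forall (x : C) u v, P u -> P v -> P (x *: u + v).

Section Subspace.
Variables (m : nat) (P : 'cV[C]_m -> Prop).
Hypothesis subP : subspace P.

Lemma subspace0 u : P u -> P 0.
Proof. by move=> Pu; rewrite -(addNr u) -scaleN1r; apply: subP. Qed.

Lemma subspaceZ x u : P u -> P (x *: u).
Proof. by move=> Pu; rewrite -[_ *: _]addr0; apply: subP Pu (subspace0 Pu). Qed.

Lemma subspaceD u v : P u -> P v -> P (u + v).
Proof. by move=> Pu Pv; rewrite -[u]scale1r; apply: subP. Qed.

Lemma subspaceB u v : P u -> P v -> P (u - v).
Proof. by move=> Pu Pv; rewrite addrC -scaleN1r; apply: subP. Qed.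
End Subspace.

(** Since $\varphi_i\neq0$, the vector $v_{i-1}$ is recovered from
    $Yv_i-\theta^*_iv_i=\varphi_iv_{i-1}$, so all basis vectors come down from $v_d$. *)
Lemma OY_cyclic (a b c : C) d (P : 'cV[C]_d.+1 -> Prop) : ~~ odd d ->
  (forall i, (0 < i <= d)%N -> Ophi a b c d i != 0) ->
  subspace P -> (forall u, P u -> P (OY a b c d *m u)) ->
  P (evec d d) -> forall w, P w.
Proof.
move=> d_even phi_neq0 subP PY Ped w.
have Pe j : (j <= d)%N -> P (evec d (d - j)).
  elim: j => [|j IH] ltjd; first by rewrite subn0.
  have Pj := IH (ltnW ltjd).
  have phij : Ophi a b c d (d - j) != 0 by apply: phi_neq0; lia.
  have -> : evec d (d - j.+1) = (Ophi a b c d (d - j))^-1 *: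
      (OY a b c d *m evec d (d - j) - Otheta b d (d - j) *: evec d (d - j)).
    rewrite OY_evec // addrC addKr scalerA mulVf // scale1r.
    by congr evec; lia.
  by apply: subspaceZ => //; apply: subspaceB => //; [apply: PY|apply: subspaceZ].
rewrite (cvec_surj w) cvec_sum; elim/big_ind: _ => [|u v|i _].
- exact: subspace0 Ped.
- exact: subspaceD.
- apply: subspaceZ => //; have := Pe (d - i)%N (leq_subr _ _).
  by rewrite subKn // -ltnS.
Qed.

(** Each application of $X$ moves the last nonzero coordinate one place up, because the subdiagonal
    of $X$ consists of ones; it ends at the coordinate of $v_d$. *)
Lemma OX_raise (a : C) d (P : 'cV[C]_d.+1 -> Prop) u :
  (forall v, P v -> P (OX a d *m v)) -> P u -> u != 0 ->
  exists2 v, P v & v ord_max 0 != 0.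
Proof.
move=> PX; rewrite (cvec_surj u); move: (fun i => _) => y Py ynz.
have [j /andP[lejd yj] jmax] :
    exists2 j, (j <= d)%N && (y j != 0) & forall l, (j < l <= d)%N -> y l = 0.
  have ex : exists j, (j <= d)%N && (y j != 0).
    have [i yi] : exists i, cvec d y i 0 != 0.
      by apply/cV0Pn.
    by exists i; rewrite mxE in yi; rewrite yi andbT -ltnS.
  have bnd j : (j <= d)%N && (y j != 0) -> (j <= d)%N by case/andP.
  case: (ex_maxnP ex bnd) => j Pj jmax; exists j => // l /andP[ltjl leld].
  by apply/eqP; apply: contraTT ltjl => yl; rewrite -leqNgt jmax // leld.
have [k dE] : exists k, (j + k = d)%N by exists (d - j)%N; rewrite subnKC.
elim: k j y Py ynz lejd yj jmax dE => [|k IH] j y Py ynz lejd yj jmax dE.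
  by exists (cvec d y) => //; rewrite mxE /= -dE addn0.
(* Beyond [j] the diagonal term is 0, and $X$ acts as the plain shift. *)
have zE l : (j < l)%N -> (l <= d)%N ->
    Otheta a d l * y l + prv y l = prv y l.
  by move=> h1 h2; rewrite jmax ?mulr0 ?add0r // h1.
apply: (IH j.+1 (fun i => Otheta a d i * y i + prv y i)); last by lia.
- by rewrite -OX_cvec; apply: PX.
- apply/cV0Pn; have ltjd : (j.+1 < d.+1)%N by lia.
  by exists (Ordinal ltjd); rewrite mxE /= zE.
- by lia.
- by rewrite zE //; lia.
- by case=> // l /andP[h1 h2]; rewrite zE //= ?jmax //; lia.
Qed.
Lemma evec_delta d (i : 'I_d.+1) : evec d i = delta_mx i 0.
Proof. by apply/colP=> k; rewrite !mxE eqxx andbT. Qed.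

(** As $Z$ is a polynomial in $X$ and $Y$, intertwining has to be checked on $X$ and $Y$ only. *)
Lemma intertwine_anticomm m (A B P Q T : 'M[C]_m) k :
  T *m P = A *m T -> T *m Q = B *m T ->
  T *m (P *m Q + Q *m P - k%:M) = (A *m B + B *m A - k%:M) *m T.
Proof.
move=> hP hQ; rewrite !(mulmxDr, mulmxDl, mulmxN, mulNmx) !mulmxA hP hQ.
by rewrite -!mulmxA hP hQ scalar_mxC.
Qed.

(** When [T] intertwines $X$, anticommuting $X$ with the defect of $Y$ gives the defect of $Z$; the
    same holds with $Y$ and $Z$ exchanged, and both uses combine in [flip_defect_rec]. *)
Lemma intertwine_defect m (A B P Q T : 'M[C]_m) k : T *m P = A *m T ->
  A *m (B *m T - T *m Q) + (B *m T - T *m Q) *m P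
  = (A *m B + B *m A - k%:M) *m T - T *m (P *m Q + Q *m P - k%:M).
Proof.
move=> hP; rewrite !(mulmxDr, mulmxDl, mulmxN, mulNmx) !mulmxA -hP.
rewrite -[B *m T *m P]mulmxA hP mulmxA scalar_mxC.
move: (A *m B *m T) (T *m P *m Q) (B *m A *m T) (T *m Q *m P) (T *m _) => u v w x y.
by apply/matrixP=> r s; rewrite !mxE; ring.
Qed.

(** The relation expands to $EP^2=E-A^2E-2AEP$, and each term on the right kills [u]. *)
Lemma defect_step m (A P E : 'M[C]_m) (u : 'cV[C]_m) :
  A *m (A *m E + E *m P) + (A *m E + E *m P) *m P = E ->
  E *m u = 0 -> E *m (P *m u) = 0 -> E *m (P *m (P *m u)) = 0.
Proof.
move=> /(congr1 (fun M => M *m u)) + Eu EPu.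
by rewrite !(mulmxDl, mulmxDr) -!mulmxA Eu EPu !mulmx0 !add0r => ->.
Qed.

(** * The intertwiner from $O_d(a,b,c)$ to a twist of $O_d(-b,a,-c)$ *)

Section FlipHom.
Variables (a b c : C) (d : nat).
Hypothesis d_even : ~~ odd d.

(** [X'] and [Y'] are the actions of $X$ and $Y$ on the twist by $((-1,1),(1\,2))$. The diagonal of
    [X'] is that of [OX a d]. *)
Let X' := OY (- b) a (- c) d.
Let Y' := - OX (- b) d.

(** In $O_d(a,b,c)$ one has $v_j=\prod_{k<j}(X-\theta_k)v_0$, so an intertwiner sends $v_j$ to the
    same product in [X'] applied to the image of $v_0$. *)
Fixpoint flip_prod (j : nat) : 'M[C]_d.+1 :=
  if j is k.+1 then flip_prod k *m (X' - (Otheta a d k)%:M) else 1%:M.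

Lemma flip_prod_comm j : X' *m flip_prod j = flip_prod j *m X'.
Proof.
elim: j => [|j IH] /=; first by rewrite mulmx1 mul1mx.
by rewrite mulmxA IH -!mulmxA mulmxBr mulmxBl scalar_mxC.
Qed.

Lemma flip_prodS j : flip_prod j.+1 = (X' - (Otheta a d j)%:M) *m flip_prod j.
Proof. by rewrite /= mulmxBr mulmxBl flip_prod_comm scalar_mxC. Qed.

(** [X'] is upper triangular: the factor with $\theta_j$ sends $v_j$ to a multiple of $v_{j-1}$,
    which the other factors kill. With all $d+1$ factors the product is 0, matching $v_{d+1}=0$ on
    the source side. *)
Lemma flip_prod_evec j i : (i < j)%N -> flip_prod j *m evec d i = 0.
Proof.
elim: j i => // j IH i; rewrite ltnS leq_eqVlt => /orP[/eqP ->|ltij].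
  rewrite /= -mulmxA mulmxBl OY_evec // mul_scalar_mx addrAC subrr add0r.
  rewrite -scalemxAr; case: j IH => [|j] IH; first by rewrite Ophi0 scale0r.
  by rewrite IH // scaler0.
by rewrite flip_prodS -mulmxA IH // mulmx0.
Qed.

(** The image of $v_0$ is $v_d$ because $v_d$ is an eigenvector of [Y'] with eigenvalue
    $\theta^*_0$. *)
Definition flip_vec j : 'cV[C]_d.+1 := flip_prod j *m evec d d.

Lemma X_flip_vec j : X' *m flip_vec j = Otheta a d j *: flip_vec j + flip_vec j.+1.
Proof.
rewrite /flip_vec flip_prodS -mulmxA mulmxBl mul_scalar_mx addrC subrK.
by rewrite mulmxA.
Qed.

Definition flip_mx : 'M[C]_d.+1 := \matrix_(r, s) flip_vec s r 0.

Lemma flip_mx_evec i : (i <= d.+1)%N -> flip_mx *m evec d i = flip_vec i.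
Proof.
rewrite leq_eqVlt => /orP[/eqP ->|ltid].
  by rewrite evec_out // mulmx0 /flip_vec flip_prod_evec.
rewrite (evec_delta (Ordinal ltid)) -colE /flip_mx /=.
by move: flip_vec => w; apply/colP=> r; rewrite !mxE.
Qed.

Lemma flip_mx_X : flip_mx *m OX a d = X' *m flip_mx.
Proof.
apply: mx_evecP => i leid; rewrite -!mulmxA OX_evec mulmxDr -scalemxAr.
by rewrite !flip_mx_evec // ?X_flip_vec // ltnW.
Qed.

Let E := Y' *m flip_mx - flip_mx *m OY a b c d.

(* Both modules satisfy [X^2 Y + 2 X Y X + Y X^2 - Y = 2 k X + l] with the same scalars
   [k], [l]; subtracting the two relations leaves one on the defect [E] alone, so that
   [E] vanishes once it kills the first two basis vectors. *)
Lemma flip_defect_rec :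
  X' *m (X' *m E + E *m OX a d) + (X' *m E + E *m OX a d) *m OX a d = E.
Proof.
have ZE : - Omod d (- b) a (- c) i3
    = X' *m Y' + Y' *m X' - (2 * a * b - c * d.+1%:R)%:M.
  rewrite /Omod /= -/X' /Y' mulmxN mulNmx.
  move: (X' *m _) (_ *m X') => u v.
  by apply/matrixP=> r s; rewrite !mxE; ring.
have -> : X' *m E + E *m OX a d
    = - Omod d (- b) a (- c) i3 *m flip_mx - flip_mx *m Omod d a b c i3.
  by rewrite ZE; apply: intertwine_defect flip_mx_X.
have := O_anticomm_XZ a b c d_even.
have := O_anticomm_YZ (- b) a (- c) d_even; rewrite -/X'.
move: (Omod d a b c i3) (Omod d (- b) a (- c) i3) => Z Z' relX' relX.
rewrite (intertwine_defect _ _ (2 * a * c - b * d.+1%:R) flip_mx_X) relX.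
rewrite addrK mulmxN mulNmx -opprD relX' /E; congr (_ *m _ - _).
by rewrite /Y'; apply/matrixP=> r s; rewrite !mxE; ring.
Qed.

Lemma flip_mx_Y : flip_mx *m OY a b c d = Y' *m flip_mx.
Proof.
apply/esym/eqP; rewrite -subr_eq0 -/E; apply/eqP/mx_evecP.
(* Two consecutive vectors are carried along, as the recursion has order two. *)
suff E0 i : E *m evec d i = 0 /\ E *m evec d i.+1 = 0.
  by move=> i _; rewrite mul0mx; case: (E0 i).
elim: i => [|i [IH0 IH1]].
  have E_evec j : (j <= d)%N -> E *m evec d j = Y' *m flip_vec j
      - (Otheta b d j *: flip_vec j + Ophi a b c d j *: flip_vec j.-1).
    move=> lejd; rewrite mulmxBl -!mulmxA OY_evec // mulmxDr -!scalemxAr.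
    by rewrite !flip_mx_evec //; lia.
  have v0 : flip_vec 0 = evec d d by rewrite /flip_vec mul1mx.
  have Yv0 : Y' *m flip_vec 0 = Otheta b d 0 *: flip_vec 0.
    rewrite v0 mulNmx OX_evec (evec_out (ltnSn d)) addr0 -scaleNr; congr (_ *: _).
    case: (signr_cases C d) => -[od sd]; first by move: d_even; rewrite od.
    by rewrite /Otheta sd expr0; field.
  split.
    by rewrite E_evec // Ophi0 scale0r addr0 Yv0 subrr.
  have [d0|d_gt0] := posnP d.
    have d_lt1 : (d < 1)%N by rewrite d0.
    by rewrite (evec_out d_lt1) mulmx0.
  rewrite E_evec //= (mulNmx (OX _ _)).
  (* The image of $v_1$ is $(X'-\theta_0)v_d$, so $Ev_1=0$ amounts to identities between the
     coefficients of $v_d$ and $v_{d-1}$. *)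
  have -> : flip_vec 1 = (Otheta a d d - Otheta a d 0) *: evec d d
      + Ophi (- b) a (- c) d d *: evec d d.-1.
    have := X_flip_vec 0; rewrite v0 OY_evec // => e.
    by rewrite scalerBl addrAC e addrAC subrr add0r.
  rewrite v0 mulmxDr -!scalemxAr !OX_evec prednK // (evec_out (ltnSn d)).
  move: (evec d d) (evec d d.-1) => u v.
  apply/matrixP=> r s; rewrite !mxE; move: (u r s) (v r s) => {u v}u v.
  move: (d) d_even d_gt0 => [//|p] /= p_odd _; rewrite /Otheta /Ophi /= p_odd.
  case: (signr_cases C p) => -[op sp]; last by move: p_odd; rewrite op.
  by rewrite exprS sp expr0 expr1; field.
have EX0 : E *m (OX a d *m evec d i) = 0.
  by rewrite OX_evec mulmxDr -scalemxAr IH0 IH1 scaler0 add0r.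
split=> //; have := defect_step flip_defect_rec IH0 EX0.
rewrite OX_evec mulmxDr -scalemxAr mulmxDr -scalemxAr EX0 OX_evec mulmxDr.
by rewrite -scalemxAr IH1 !scaler0 !add0r.
Qed.

Hypothesis phi_neq0 : forall i, (0 < i <= d)%N -> Ophi (- b) a (- c) d i != 0.

(** The image is stable under [X'] and contains $v_d$, from which [X'] generates everything. *)
Lemma flip_mx_surj (w : 'cV[C]_d.+1) : exists v, w = flip_mx *m v.
Proof.
apply: (OY_cyclic d_even phi_neq0 (P := fun w => exists v, w = flip_mx *m v)).
- move=> x _ _ [u ->] [v ->]; exists (x *: u + v).
  by rewrite mulmxDr scalemxAr.
- by move=> _ [u ->]; exists (OX a d *m u); rewrite !mulmxA flip_mx_X.
- by exists (evec d 0); rewrite flip_mx_evec // /flip_vec mul1mx.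
Qed.

Lemma flip_mx_unit : flip_mx \in unitmx.
Proof.
suff [S TS1] : exists S, flip_mx *m S = 1%:M by have [] := mulmx1_unit TS1.
have ex (j : 'I_d.+1) : exists v, col j 1%:M == flip_mx *m v :> 'cV_d.+1.
  by have [v ->] := flip_mx_surj (col j 1%:M); exists v.
exists (\matrix_(r, s) xchoose (ex s) r 0).
apply/trmx_inj/row_matrixP=> j; rewrite -!tr_col; congr (_^T).
rewrite (eqP (xchooseP (ex j))) !colE -mulmxA -colE; congr (_ *m _).
by apply/colP=> r; rewrite !mxE.
Qed.

Lemma flip_irreducible (P : 'cV[C]_d.+1 -> Prop) :
  (forall i, (0 < i <= d)%N -> Ophi a b c d i != 0) ->
  subspace P -> (forall v, P v -> P (OX (- b) d *m v)) ->
  (forall v, P v -> P (OY (- b) a (- c) d *m v)) ->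
  forall u, P u -> u != 0 -> forall w, P w.
Proof.
move=> phi_neq0' subP PX PY u Pu u_neq0 w.
have [v Pv vd] := OX_raise PX Pu u_neq0.
have Pprod j : P (flip_prod j *m v).
  elim: j => [|j IH]; first by rewrite mul1mx.
  rewrite flip_prodS -mulmxA mulmxBl mul_scalar_mx.
  by apply: subspaceB => //; [apply: PY|apply: subspaceZ].
(* The product of [d] factors kills $v_0,\dots,v_{d-1}$, so only the nonzero last coordinate of [v]
   survives. *)
have Pd : P (flip_mx *m evec d d).
  have := Pprod d; rewrite {1}(cvec_surj v) cvec_sum mulmx_sumr big_ord_recr /=.
  rewrite big1 ?add0r => [|i _]; last first.
    by rewrite -scalemxAr flip_prod_evec ?scaler0.
  rewrite -scalemxAr flip_mx_evec // => /(subspaceZ subP (v ord_max 0)^-1).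
  have -> : inord d = ord_max :> 'I_d.+1 by apply: val_inj; rewrite /= inordK.
  by rewrite scalerA mulVf // scale1r.
have [y ->] := flip_mx_surj w.
apply: (OY_cyclic d_even phi_neq0' (P := fun y => P (flip_mx *m y))) => //.
- by move=> x s t Ps Pt; rewrite mulmxDr -scalemxAr; apply: subP.
- move=> s Ps; rewrite mulmxA flip_mx_Y /Y' !mulNmx -mulmxA -scaleN1r.
  by apply: subspaceZ => //; apply: PX.
Qed.

End FlipHom.

Lemma mx_iso_sym m (W1 W2 : bimod R m) : mx_iso W1 W2 -> mx_iso W2 W1.
Proof.
move=> [P [Pu PW]]; exists (invmx P); split; first by rewrite unitmx_inv.
by move=> g; apply: (canRL (mulmxK Pu)); rewrite -mulmxA -PW mulKmx.
Qed.

Lemma mx_iso_trans m (W1 W2 W3 : bimod R m) :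
  mx_iso W1 W2 -> mx_iso W2 W3 -> mx_iso W1 W3.
Proof.
move=> [P [Pu PW]] [Q [Qu QW]]; exists (Q *m P); split; first by rewrite unitmx_mul Qu.
by move=> g; rewrite -mulmxA PW !mulmxA QW.
Qed.

Lemma ord3_ind (P : 'I_3 -> Prop) : P i1 -> P i2 -> P i3 -> forall g, P g.
Proof.
move=> P1 P2 P3 [[|[|[|//]]] lt3].
- by rewrite (_ : Ordinal lt3 = i1) //; apply: val_inj.
- by rewrite (_ : Ordinal lt3 = i2) //; apply: val_inj.
- by rewrite (_ : Ordinal lt3 = i3) //; apply: val_inj.
Qed.

Lemma tperm12_3 : tperm i1 i2 i3 = i3.
Proof. by rewrite tpermD. Qed.

Lemma flip_iso (a b c : C) d : ~~ odd d ->
  (forall i, (0 < i <= d)%N -> Ophi (- b) a (- c) d i != 0) ->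
  mx_iso (Omod d a b c) (twist (-1) 1 (tperm i1 i2) (Omod d (- b) a (- c))).
Proof.
move=> d_even phi0; exists (flip_mx a b c d); split; first exact: flip_mx_unit.
have TX := flip_mx_X a b c d_even; have TY := flip_mx_Y a b c d_even.
elim/ord3_ind; rewrite /twist ?tpermL ?tpermR ?tperm12_3 /sgnaut.
- by rewrite /= scale1r.
- by rewrite /= scaleN1r.
rewrite (intertwine_anticomm _ TX TY) /=; congr (_ *m _).
rewrite mulr1 scaleN1r /Omod /= mulmxN mulNmx.
move: (OX _ _ *m _) (_ *m OX _ _) => u v.
by apply/matrixP=> r s; rewrite !mxE; ring.
Qed.

(** The same matrix serves, with the twist moved to the other side: $((1,-1),(1\,2))$ is inverse to
    $((-1,1),(1\,2))$. *)
Lemma flip_swap_iso (a b c : C) d : ~~ odd d ->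
  (forall i, (0 < i <= d)%N -> Ophi (- b) a (- c) d i != 0) ->
  mx_iso (twist 1 (-1) (tperm i1 i2) (Omod d a b c)) (Omod d (- b) a (- c)).
Proof.
move=> d_even phi0; exists (flip_mx a b c d); split; first exact: flip_mx_unit.
have TX := flip_mx_X a b c d_even; have TY := flip_mx_Y a b c d_even.
elim/ord3_ind; rewrite /twist ?tpermL ?tpermR ?tperm12_3 /sgnaut.
- by rewrite /= -scalemxAr scaleN1r TY mulNmx opprK.
- by rewrite /= scale1r.
rewrite -scalemxAr (intertwine_anticomm _ TX TY) scalemxAl /=; congr (_ *m _).
rewrite mul1r scaleN1r /Omod /= mulmxN mulNmx.
move: (OX _ _ *m _) (_ *m OX _ _) => u v.
by apply/matrixP=> r s; rewrite !mxE; ring.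
Qed.

(** * Reversing the order of the basis *)

Section Reversal.
Variables (a b c : C) (d : nat).
Hypothesis d_even : ~~ odd d.
Hypothesis phi_neq0 : forall i, (0 < i <= d)%N -> Ophi a b c d i != 0.

(** Comparing the actions of $X$ under $v_j\mapsto c_jv_{d-j}$ forces
    $c_{j+1}=-\varphi_{j+1}c_j$. *)
Definition rev_coef (j : nat) : C := \prod_(0 <= i < j) - Ophi a b c d i.+1.

Definition rev_mx : 'M[C]_d.+1 :=
  \matrix_(r, s) (rev_coef s * (r == rev_ord s)%:R).

Lemma rev_coefS j : rev_coef j.+1 = rev_coef j * - Ophi a b c d j.+1.
Proof. exact: big_nat_recr. Qed.

Lemma rev_coef_neq0 j : (j <= d)%N -> rev_coef j != 0.
Proof.
elim: j => [|j IH] lejd; first by rewrite /rev_coef big_geq // oner_eq0.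
by rewrite rev_coefS mulf_neq0 ?oppr_eq0 ?phi_neq0 // IH // ltnW.
Qed.

Lemma rev_mx_evec j : (j <= d)%N -> rev_mx *m evec d j = rev_coef j *: evec d (d - j).
Proof.
move=> lejd; have ltjd : (j < d.+1)%N by [].
rewrite (evec_delta (Ordinal ltjd)) -colE.
by apply/colP=> r; rewrite !mxE -val_eqE /= subSS.
Qed.

Lemma rev_mx_unit : rev_mx \in unitmx.
Proof.
pose S : 'M[C]_d.+1 := \matrix_(r, s) ((rev_coef r)^-1 * (s == rev_ord r)%:R).
have [] // : rev_mx \in unitmx /\ S \in unitmx.
apply: mulmx1_unit; apply/matrixP=> r s; rewrite !mxE (bigD1 (rev_ord r)) //=.
rewrite !mxE rev_ordK eqxx mulr1 mulrA mulfV ?mul1r; last first.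
  by apply: rev_coef_neq0; rewrite -ltnS ltn_ord.
rewrite big1 ?addr0 => [|i ni]; first by rewrite eq_sym.
by rewrite !mxE [r == _]eq_sym (can2_eq (@rev_ordK _) (@rev_ordK _)) (negbTE ni) mulr0 mul0r.
Qed.

Lemma rev_mx_X : rev_mx *m OX a d = - OY (- b) (- a) c d *m rev_mx.
Proof.
apply: mx_evecP => j lejd.
(* For $j=d$ both sides are 0, the right one through $\varphi_{d+1}=0$. *)
have rev_succ : rev_mx *m evec d j.+1 = rev_coef j.+1 *: evec d (d - j.+1).
  move: lejd; rewrite leq_eqVlt => /orP[/eqP ->|]; last exact: rev_mx_evec.
  by rewrite evec_out // mulmx0 rev_coefS Ophi_max // oppr0 mulr0 scale0r.
rewrite -!mulmxA OX_evec mulmxDr -scalemxAr rev_succ (rev_mx_evec lejd).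
rewrite -scalemxAr mulNmx OY_evec // -subnS.
rewrite rev_coefS.
move: (evec d _) (evec d _) => u v; apply/matrixP=> r s; rewrite !mxE.
move: (u r s) (v r s) (rev_coef j) => {u v}u v w.
(* As $d$ is even, [d - j] and [j.+1] have opposite parity, so the even formula for $\varphi$ is
   matched with the odd one. *)
have -> : Ophi (- b) (- a) c d (d - j) = Ophi a b c d j.+1.
  rewrite /Ophi /= oddB // (negbTE d_even) /=; case: (odd j).
  - by rewrite /= natrB //; field.
  - by rewrite /= natrB //; field.
rewrite /Otheta natrB // -(signr_odd _ (d - j)) oddB // (negbTE d_even) signr_odd.
by field.
Qed.

Lemma rev_mx_Y : rev_mx *m OY a b c d = - OX (- b) d *m rev_mx.
Proof.
apply: mx_evecP => j lejd; rewrite -!mulmxA OY_evec // mulmxDr -!scalemxAr.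
rewrite !rev_mx_evec //; last by lia.
rewrite -scalemxAr mulNmx OX_evec.
have -> : Ophi a b c d j *: (rev_coef j.-1 *: evec d (d - j.-1))
   = - rev_coef j *: evec d (d - j).+1.
  case: j lejd => [|j] lejd; first by rewrite Ophi0 scale0r subn0 evec_out // scaler0.
  by rewrite rev_coefS -subSn // subSS scalerA mulrN opprK mulrC.
move: (evec d _) (evec d _) => u v; apply/matrixP=> r s; rewrite !mxE.
rewrite /Otheta natrB // -(signr_odd _ (d - j)) oddB // (negbTE d_even) signr_odd.
by field.
Qed.

Lemma rev_iso :
  mx_iso (Omod d a b c) (twist (-1) (-1) (tperm i1 i2) (Omod d (- b) (- a) c)).
Proof.
exists rev_mx; split; first exact: rev_mx_unit.
have TX := rev_mx_X; have TY := rev_mx_Y.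
elim/ord3_ind; rewrite /twist ?tpermL ?tpermR ?tperm12_3 /sgnaut.
- by rewrite /= scaleN1r.
- by rewrite /= scaleN1r.
rewrite (intertwine_anticomm _ TX TY) /=; congr (_ *m _).
rewrite mulrNN mulr1 scale1r /Omod /= !(mulmxN, mulNmx) !opprK.
move: (OX _ _ *m _) (_ *m OX _ _) => u v.
by apply/matrixP=> r s; rewrite !mxE; ring.
Qed.
End Reversal.

End BidiagonalModules.

(** * Irreducibility *)

Section Irreducibility.
Variable R : realType.
Local Notation C := (R[i]).

(** Passes from the row-space encoding to predicates on column vectors, in which the arguments on
    $O_d$ are phrased. *)
Lemma irreducibleI m (W : bimod R m) : (0 < m)%N ->
  (forall P : 'cV[C]_m -> Prop, subspace P ->
     (forall g v, P v -> P (W g *m v)) ->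
     forall u, P u -> u != 0 -> forall w, P w) ->
  irreducible W.
Proof.
move=> m_gt0 irrW; split=> // U stabU.
have [->|U_neq0] := eqVneq U 0; first by left; rewrite submx_refl.
right; rewrite -sub1mx; apply/row_subP=> i.
pose P (v : 'cV[C]_m) := (v^T <= U)%MS.
have [j row_neq0] : exists j, row j U != 0.
  by apply/existsP; rewrite -negb_forall; apply: contraNN U_neq0 => /forallP U0;
     apply/eqP/row_matrixP=> j; rewrite row0; apply/eqP.
suff: P (row i 1%:M)^T by rewrite /P trmxK.
apply: (irrW P _ _ (row j U)^T); rewrite /P.
- move=> x u v Pu Pv; rewrite linearP /=; apply: addmx_sub => //.
  exact: scalemx_sub.
- move=> g v Pv; rewrite trmx_mul; apply: submx_trans (stabU g).
  exact: submxMr.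
- by rewrite trmxK row_sub.
- by rewrite -trmx0 (inj_eq trmx_inj).
Qed.

Lemma irreducible_twist m e1 e2 s (W : bimod R m) : e1 != 0 -> e2 != 0 ->
  irreducible W -> irreducible (twist e1 e2 s W).
Proof.
move=> e1_neq0 e2_neq0 [m_gt0 irrW]; split=> // U stabU; apply: irrW => g.
have := stabU ((s^-1)%g g); rewrite /twist permKV linearZ /= -scalemxAr.
rewrite eqmx_scale //.
by rewrite /sgnaut; case: ifP => // _; case: ifP => // _; rewrite mulf_neq0.
Qed.

Lemma irreducible_mx_iso m (W1 W2 : bimod R m) :
  mx_iso W1 W2 -> irreducible W1 -> irreducible W2.
Proof.
move=> [P [Pu PW]] [m_gt0 irrW]; split=> // U stabU.
have PuT : P^T \in unitmx by rewrite unitmx_tr.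
have [g||] := irrW (U *m invmx P^T).
- have -> : W1 g = invmx P *m W2 g *m P by rewrite -mulmxA -PW mulKmx.
  rewrite !trmx_mul trmx_inv -mulmxA [invmx _ *m (_ *m _)]mulmxA.
  by rewrite mulVmx // mul1mx mulmxA submxMr.
- move=> /eqmx0P U0; left.
  by rewrite -(mulmxKV PuT U) U0 mul0mx submx_refl.
- by rewrite /row_full mxrankMfree ?row_free_unit ?unitmx_inv //; right.
Qed.

Lemma OmodN_irreducible (a b c : C) d : ~~ odd d ->
  (forall i, (0 < i <= d)%N -> Ophi a b c d i != 0) ->
  (forall i, (0 < i <= d)%N -> Ophi (- b) a (- c) d i != 0) ->
  irreducible (Omod d (- b) a (- c)).
Proof.
move=> d_even phi1 phi2; apply: irreducibleI => // P subP PW.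
apply: (flip_irreducible d_even phi2 phi1 subP) => v Pv.
  exact: (PW i1 v Pv).
exact: (PW i2 v Pv).
Qed.

Lemma Omod_irreducible (a b c : C) d : ~~ odd d ->
  (forall i, (0 < i <= d)%N -> Ophi a b c d i != 0) ->
  (forall i, (0 < i <= d)%N -> Ophi (- b) a (- c) d i != 0) ->
  irreducible (Omod d a b c).
Proof.
move=> d_even phi1 phi2; apply: irreducible_mx_iso (mx_iso_sym (flip_iso d_even phi2)) _.
by apply: irreducible_twist; rewrite ?oppr_eq0 ?oner_eq0 //; apply: OmodN_irreducible.
Qed.

Lemma Ophi_sym (a b c : C) d i : Ophi a b c d i = Ophi b a c d i.
Proof. by rewrite /Ophi; case: ifP => _; field. Qed.

(** Reversal leads to a twist of $O_d(-b,-a,c)$, and the flip of that module to $O_d(a,-b,-c)$; the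
    two transpositions cancel and a sign remains. *)
Lemma rev_flip_iso (a b c : C) d : ~~ odd d ->
  (forall i, (0 < i <= d)%N -> Ophi a b c d i != 0) ->
  (forall i, (0 < i <= d)%N -> Ophi (- b) a (- c) d i != 0) ->
  mx_iso (twist 1 (-1) 1 (Omod d a b c)) (Omod d a (- b) (- c)).
Proof.
move=> d_even phi1 phi2.
have := flip_swap_iso (a := - b) (b := - a) (c := c) d_even; rewrite opprK.
move=> /(_ (fun i hi => etrans (congr1 (fun x => x != 0) (Ophi_sym _ _ _ _ _)) (phi2 i hi))).
apply: mx_iso_trans.
have [P [Pu PW]] := rev_iso d_even phi1; exists P; split=> // g.
rewrite /twist perm1 -scalemxAr PW /twist scalemxAl scalerA; congr (_ *: _ *m _).
by elim/ord3_ind: g; rewrite ?tpermL ?tpermR ?tperm12_3 /sgnaut /=; ring.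
Qed.

Lemma Ophi_neq0 (a b c : C) d i : (0 < i <= d)%N ->
  (if odd i then d.+1%:R - 2 * i%:R - 2 * a - 2 * b + 2 * c
   else d.+1%:R - 2 * i%:R - 2 * a - 2 * b - 2 * c) != 0 ->
  Ophi a b c d i != 0.
Proof.
move=> /andP[i_gt0 leid]; rewrite /Ophi; case: (odd i) => /= e_neq0;
  rewrite !mulf_neq0 ?invr_eq0 ?pnatr_eq0 -?lt0n //.
by rewrite subr_eq0 eqr_nat ltn_eqF.
Qed.

Lemma cRD (x y : R) : cR (x + y) = cR x + cR y.
Proof. exact: rmorphD. Qed.

(** The linear factors of the $\varphi_i$ below all take this shape with $x=k_3$; the constant
    [m.+1] keeps them away from 0. *)
Lemma affine_neq0 (e s : C) (m j : nat) (x : R) : 0 <= x -> s != 0 ->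
  e = s * (m.+1%:R + j%:R * cR x) -> e != 0.
Proof.
move=> x_ge0 s_neq0 ->; rewrite mulf_neq0 //.
have -> : m.+1%:R + j%:R * cR x = cR (m.+1%:R + j%:R * x).
  by rewrite /cR rmorphD rmorphM !rmorph_nat.
by rewrite fmorph_eq0 lt0r_neq0 // ltr_pwDl ?ltr0Sn // mulr_ge0 // ler0n.
Qed.

(** * Nonvanishing of the $\varphi_i$ for the parameters of $W_1,W_2,W_3$ *)

Section SingularCase.
Variables (k1 k2 k3 : R) (d p q : nat).
Hypotheses (d_even : ~~ odd d) (p_even : ~~ odd p).
Hypotheses (k1E : 2 * cR k1 = - p.+1%:R) (k2E : 2 * cR k2 = - q.+1%:R).
Hypothesis k3_ge0 : 0 <= k3.

Let k1E' : cR k1 = - p.+1%:R / 2.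
Proof. by rewrite -k1E; field. Qed.
Let k2E' : cR k2 = - q.+1%:R / 2.
Proof. by rewrite -k2E; field. Qed.

(** The parameters stand for $p=t_1-1$, $q=t_2-1$ and $d=n-t_1-t_2$, from which $n$ is rebuilt. *)
Let n := (d + p.+1 + q.+1)%N.
Let N : C := n.+1%:R / 2.
Let K : C := cR (k1 + k2 + k3).

Let two_neq0 : (2 : C) != 0. Proof. by rewrite pnatr_eq0. Qed.
Let mtwo_neq0 : (- 2 : C) != 0. Proof. by rewrite oppr_eq0 pnatr_eq0. Qed.

(** Here $k_3$ cancels: the linear factor is $-2(p+i+1)$ for odd $i$ and $2(q+d-i+2)$ for even $i$.
    The witnesses [s], [m], [j] of the next lemmas come from the same computation. *)
Lemma Ophi1_neq0 i : (0 < i <= d)%N ->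
  Ophi (cR k2 + cR k3 + N) (- cR k1 - cR k3 - N) (- N) d i != 0.
Proof.
move=> hi; apply: Ophi_neq0 => //; have /andP[_ /subnKC dE] := hi.
rewrite k1E' k2E' /N /n -dE; case: ifP => _.
  by apply: (affine_neq0 (s := - 2) (m := p + i) (j := 0) k3_ge0) => //; field.
by apply: (affine_neq0 (s := 2) (m := q + (d - i) + 1) (j := 0) k3_ge0) => //; field.
Qed.

(** The factor now contains $4k_3$, and $k_3\geq0$ keeps it positive: for even $i$ it is
    $2(d-i+1+2k_3)$. *)
Lemma Ophi1'_neq0 i : (0 < i <= d)%N ->
  Ophi (- cR k1 - cR k3 - N) (- (cR k2 + cR k3 + N)) N d i != 0.
Proof.
move=> hi; apply: Ophi_neq0 => //; have /andP[_ /subnKC dE] := hi.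
rewrite k1E' k2E' /N /n -dE; case: ifP => _.
  apply: (affine_neq0 (s := 2) (m := i + (d - i) + p.+1 + q.+1 + (d - i) + 1)
    (j := 2) k3_ge0) => //; by field.
by apply: (affine_neq0 (s := 2) (m := d - i) (j := 2) k3_ge0) => //; field.
Qed.

Lemma Ophi2_neq0 i : (0 < i <= p)%N ->
  Ophi (cR k3) (- K - n%:R - 1) (- cR k2) p i != 0.
Proof.
move=> hi; apply: Ophi_neq0 => //; have /andP[_ /subnKC pE] := hi.
rewrite /K !cRD k1E' k2E' /N /n -pE; case: ifP => _.
  by apply: (affine_neq0 (s := 2) (m := d + q + (p - i) + 2) (j := 0) k3_ge0) => //; field.
by apply: (affine_neq0 (s := 2) (m := d + (p - i) + 1) (j := 0) k3_ge0) => //; field.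
Qed.

Lemma Ophi2'_neq0 i : (0 < i <= p)%N ->
  Ophi (K + n%:R + 1) (cR k3) (cR k2) p i != 0.
Proof.
move=> hi; apply: Ophi_neq0 => //; have /andP[_ /subnKC pE] := hi.
rewrite /K !cRD k1E' k2E' /N /n -pE; case: ifP => _.
  by apply: (affine_neq0 (s := - 2) (m := i + d + q + 1) (j := 2) k3_ge0) => //; field.
by apply: (affine_neq0 (s := - 2) (m := i + d) (j := 2) k3_ge0) => //; field.
Qed.

(** This module sits on the target side $O_d(-b,a,-c)$ of a flip. *)
Lemma O1_irreducible :
  irreducible (Omod d (cR k2 + cR k3 + N) (- cR k1 - cR k3 - N) (- N)).
Proof.
have := OmodN_irreducible (a := - cR k1 - cR k3 - N) (b := - (cR k2 + cR k3 + N))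
  (c := N) d_even.
by rewrite opprK; apply; [apply: Ophi1'_neq0 | apply: Ophi1_neq0].
Qed.

Lemma O1_iso : mx_iso
  (twist (-1) 1 (tperm i1 i2) (Omod d (cR k2 + cR k3 + N) (- cR k1 - cR k3 - N) (- N)))
  (Omod d (- cR k1 - cR k3 - N) (- cR k2 - cR k3 - N) N).
Proof.
have := flip_iso (a := - cR k1 - cR k3 - N) (b := - (cR k2 + cR k3 + N)) (c := N) d_even.
rewrite opprK => /(_ Ophi1_neq0) /mx_iso_sym.
by rewrite !opprD.
Qed.

Let flipE : - (- K - n%:R - 1) = K + n%:R + 1.
Proof. by ring. Qed.

Lemma O2_irreducible : irreducible (Omod p (cR k3) (- K - n%:R - 1) (- cR k2)).
Proof.
apply: Omod_irreducible => //; first exact: Ophi2_neq0.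
by rewrite flipE opprK; apply: Ophi2'_neq0.
Qed.

Lemma O2_iso : mx_iso
  (twist 1 (-1) (tperm i1 i2) (Omod p (cR k3) (- K - n%:R - 1) (- cR k2)))
  (Omod p (K + n%:R + 1) (cR k3) (cR k2)).
Proof.
have := flip_swap_iso (a := cR k3) (b := - K - n%:R - 1) (c := - cR k2) p_even.
by rewrite flipE opprK; apply; apply: Ophi2'_neq0.
Qed.

(** Used for $W_3$, with the indices 1 and 2 exchanged. *)
Lemma O3_iso : mx_iso
  (twist 1 (-1) 1 (Omod p (cR k3) (- K - n%:R - 1) (- cR k2)))
  (Omod p (cR k3) (K + n%:R + 1) (cR k2)).
Proof.
have := rev_flip_iso (a := cR k3) (b := - K - n%:R - 1) (c := - cR k2) p_even.
by rewrite flipE opprK; apply; [apply: Ophi2_neq0 | apply: Ophi2'_neq0].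
Qed.
End SingularCase.
End Irreducibility.

(** * Coefficients of Dunkl operators *)

Section Coefficients.
Variable R : realType.
Local Notation C := (R[i]).
Local Notation Pol := ({mpoly C[3]}).
Implicit Types (p : Pol) (m : 'X_{1..3}) (i : 'I_3).

Lemma sum_msupp_eq p m (F : 'X_{1..3} -> C) : (p@_m = 0 -> F m = 0) ->
  \sum_(m' <- msupp p) (m' == m)%:R * F m' = F m.
Proof.
move=> F0; have [pm|pm] := boolP (m \in msupp p).
  rewrite (bigD1_seq m) ?msupp_uniq //= eqxx mul1r big1 ?addr0 // => m' /negbTE ->.
  by rewrite mul0r.
rewrite F0; last by apply/eqP; rewrite mcoeff_eq0.
rewrite big_seq big1 // => m' pm'.
by case: eqP pm => [<-|]; rewrite ?pm' ?mul0r.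
Qed.

Lemma mcoeff_refl i p m : (refl i p)@_m = (-1) ^+ m i * p@_m.
Proof.
rewrite /refl comp_mpolyEX raddf_sum /=.
rewrite -(@sum_msupp_eq p m (fun m => (-1) ^+ m i * p@_m)); last by move=> ->; rewrite mulr0.
apply: eq_bigr => m' _; rewrite comp_mpolyX mcoeffZ.
have -> : \prod_(j < 3) tnth [tuple if j == i then - 'X_j else 'X_j | j < 3] j ^+ m' j
    = (-1) ^+ m' i *: 'X_[m'] :> Pol.
  transitivity (\prod_(j < 3) ((if j == i then (-1) ^+ m' i else 1 : Pol) * 'X_j ^+ m' j)).
    apply: eq_bigr => j _; rewrite tnth_mktuple.
    by have [->|_] := eqVneq j i; rewrite ?mul1r ?[LHS]exprNn.
  rewrite big_split /= -big_mkcond big_pred1_eq -mpolyXE_id -signr_odd.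
  by rewrite -[in RHS]signr_odd; case: (odd _); rewrite ?mulN1r ?scaleN1r ?mul1r ?scale1r.
by rewrite mcoeffZ mcoeffX; ring.
Qed.

(** Monomials without $x_i$ are dropped on the left and are never of the form [m + U_(i)] on the
    right. *)
Lemma mcoeff_divX i p m : (divX i p)@_m = p@_(m + U_(i)).
Proof.
rewrite /divX raddf_sum /=.
rewrite -(@sum_msupp_eq p (m + U_(i))%MM (fun m => p@_m)) // [LHS]big_mkcond /=.
apply: eq_bigr => m' _; rewrite mcoeffZ mcoeffX mulrC.
have -> : (m' == m + U_(i))%MM = (0 < m' i)%N && ((m' - U_(i))%MM == m).
  apply/eqP/andP => [->|[m'i /eqP <-]]; first by rewrite mnmDE mnm1E eqxx addn1 addmK.
  rewrite submK //; apply/mnm_lepP => j; rewrite mnm1E.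
  by case: eqP => // <-.
by case: ifP => //=; rewrite mul0r.
Qed.

(** The Dunkl number: $T_ix_i^j$ is [br k j] times $x_i^{j-1}$. It equals $j$ for even $j$ and
    $j+2k$ for odd $j$. *)
Definition br (k : R) (j : nat) : C := j%:R + cR k * (1 - (-1) ^+ j).

Lemma mcoeff_dunkl k1 k2 k3 i p m :
  (dunkl k1 k2 k3 i p)@_m = br (kof k1 k2 k3 i) (m i).+1 * p@_(m + U_(i)).
Proof.
rewrite /dunkl mcoeffD mcoeffZ mcoeff_deriv mcoeff_divX mcoeffB mcoeff_refl.
by rewrite mnmDE mnm1E eqxx addn1 /br -mulr_natr; ring.
Qed.

Lemma mcoeff_mulX i p m :
  ('X_i * p)@_m = if (0 < m i)%N then p@_(m - U_(i)) else 0.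
Proof.
rewrite mulrC; case: ifP => mi.
  rewrite -{1}(@submK _ U_(i)%MM m) ?[(_ - _ + _)%MM]addmC ?mcoeffMX //.
  by apply/mnm_lepP => j; rewrite mnm1E; case: eqP => // <-.
apply/eqP; rewrite mcoeff_eq0 (perm_mem (msuppMX _ _)); apply/negP => /mapP [m' _ mE].
by move: mi; rewrite mE mnmDE mnm1E eqxx.
Qed.

Definition mon3 (a b c : nat) : 'X_{1..3} := Multinom [tuple a; b; c].

Lemma mon3_1 a b c : mon3 a b c i1 = a. Proof. by rewrite multinomE. Qed.
Lemma mon3_2 a b c : mon3 a b c i2 = b. Proof. by rewrite multinomE. Qed.
Lemma mon3_3 a b c : mon3 a b c i3 = c. Proof. by rewrite multinomE. Qed.

Lemma mon3_eta m : m = mon3 (m i1) (m i2) (m i3).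
Proof. by apply/mnmP; elim/ord3_ind; rewrite ?mon3_1 ?mon3_2 ?mon3_3. Qed.

Lemma mdeg_mon3 a b c : mdeg (mon3 a b c) = (a + b + c)%N.
Proof.
rewrite mdegE !big_ord_recr big_ord0 /= add0n.
by congr (_ + _ + _)%N; rewrite multinomE.
Qed.

Lemma mon3S1 a b c : (mon3 a b c + U_(i1))%MM = mon3 a.+1 b c.
Proof.
by apply/mnmP; elim/ord3_ind; rewrite mnmDE mnm1E ?mon3_1 ?mon3_2 ?mon3_3 ?addn0 ?addn1.
Qed.

Lemma mon3S2 a b c : (mon3 a b c + U_(i2))%MM = mon3 a b.+1 c.
Proof.
by apply/mnmP; elim/ord3_ind; rewrite mnmDE mnm1E ?mon3_1 ?mon3_2 ?mon3_3 ?addn0 ?addn1.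
Qed.

Lemma mon3S3 a b c : (mon3 a b c + U_(i3))%MM = mon3 a b c.+1.
Proof.
by apply/mnmP; elim/ord3_ind; rewrite mnmDE mnm1E ?mon3_1 ?mon3_2 ?mon3_3 ?addn0 ?addn1.
Qed.

Lemma mon3B1 a b c : (mon3 a.+1 b c - U_(i1))%MM = mon3 a b c.
Proof. by rewrite -mon3S1 addmK. Qed.

Lemma mon3B2 a b c : (mon3 a b.+1 c - U_(i2))%MM = mon3 a b c.
Proof. by rewrite -mon3S2 addmK. Qed.
End Coefficients.

(** * The kernel of the Dirac operator *)

Section DiracKernel.
Variables (R : realType) (k1 k2 k3 : R) (n : nat).
Local Notation C := (R[i]).
Local Notation Pol := ({mpoly C[3]}).
Local Notation Mn := (Mn k1 k2 k3 n).
Implicit Types (s : bool) (v : V R) (a b c : nat).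

Lemma iC_sqr : iC R * iC R = -1.
Proof. by rewrite -expr2; exact: sqr_i. Qed.

Definition cf s v a b c : C := (if s then v.1 else v.2)@_(mon3 a b c).

(** The eigenvalue of $\sigma_3$ on the component [s]; $\sigma_1$ and $\sigma_2$ exchange the
    components, whence [~~ s] below. *)
Definition sgn s : C := if s then 1 else -1.

Lemma mpoly3_eq0 (p : Pol) : (forall a b c, p@_(mon3 a b c) = 0) -> p = 0.
Proof. by move=> p0; apply/mpolyP=> m; rewrite mcoeff0 (mon3_eta m) p0. Qed.

Lemma mcoeff_lin2 (x y : C) (p q r : Pol) m :
  (p + x *: q + y *: r)@_m = p@_m + x * q@_m + y * r@_m.
Proof. by rewrite !mcoeffD !mcoeffZ. Qed.

Lemma Dirac_comp v s :
  (if s then (Dirac k1 k2 k3 v).1 else (Dirac k1 k2 k3 v).2)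
  = dunkl k1 k2 k3 i1 (if s then v.2 else v.1)
    + (- iC R * sgn s) *: dunkl k1 k2 k3 i2 (if s then v.2 else v.1)
    + sgn s *: dunkl k1 k2 k3 i3 (if s then v.1 else v.2).
Proof.
by case: s; rewrite /sgn ?mulr1 ?mulrN1 ?opprK ?scale1r ?scaleN1r ?scaleNr.
Qed.

Lemma Dirac_coef v s a b c :
  (if s then (Dirac k1 k2 k3 v).1 else (Dirac k1 k2 k3 v).2)@_(mon3 a b c)
  = br k1 a.+1 * cf (~~ s) v a.+1 b c
    - iC R * sgn s * (br k2 b.+1 * cf (~~ s) v a b.+1 c)
    + sgn s * (br k3 c.+1 * cf s v a b c.+1).
Proof.
rewrite Dirac_comp mcoeff_lin2 -2!mulNr; congr (_ + _ * _ + _ * _);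
  by rewrite mcoeff_dunkl ?mon3_1 ?mon3_2 ?mon3_3 ?mon3S1 ?mon3S2 ?mon3S3 /cf; case: s.
Qed.

(** The Dirac equation is solved for the highest power of $x_3$, which turns it into a recursion on
    the $x_3$-degree. *)
Lemma Mn_coefP v : Mn v <->
  (forall s a b c, (a + b + c)%N <> n -> cf s v a b c = 0) /\
  (forall s a b c, br k3 c.+1 * cf s v a b c.+1
     = - sgn s * (br k1 a.+1 * cf (~~ s) v a.+1 b c)
       + iC R * (br k2 b.+1 * cf (~~ s) v a b.+1 c)).
Proof.
have sgn2 s : sgn s * sgn s = 1 by case: s; rewrite /sgn; ring.
split=> [[h1 h2 D0]|[hdeg hD]].
  split=> s a b c.
    move=> deg; rewrite /cf; apply: (dhomog_nemf_coeff (d := n)).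
      by case: (s); [exact: h1|exact: h2].
    by apply/eqP=> e; apply: deg; rewrite -e; exact/esym/mdeg_mon3.
  have := Dirac_coef v s a b c; rewrite D0 /=.
  have -> : (if s then 0 else 0)@_(mon3 a b c) = 0 :> C by case: s; rewrite mcoeff0.
  move=> /(congr1 ( *%R (sgn s))); rewrite mulr0 => e.
  apply/eqP; rewrite -subr_eq0; apply/eqP; rewrite [RHS]e.
  by case: (s); rewrite /sgn; ring.
have hom s : (if s then v.1 else v.2) \is n.-homog.
  apply/dhomogP => m mv; change (mdeg m = n); move: mv.
  rewrite mcoeff_msupp (mon3_eta m) mdeg_mon3 => mv.
  apply/eqP; apply: contraNT mv => /eqP deg.
  by apply/eqP; apply: hdeg.
split; [exact: (hom true)|exact: (hom false)|].
have D0 s a b c :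
    (if s then (Dirac k1 k2 k3 v).1 else (Dirac k1 k2 k3 v).2)@_(mon3 a b c) = 0.
  by rewrite Dirac_coef hD; case: (s); rewrite /sgn; ring.
case: (Dirac k1 k2 k3 v) D0 => p q D0.
by congr pair; apply: mpoly3_eq0 => a b c; [have := D0 true|have := D0 false]; apply.
Qed.

Hypothesis br3_neq0 : forall j, (0 < j <= n)%N -> br k3 j != 0.

(** The coefficient at $(a,b,c+1)$ depends on those at $(a+1,b,c)$ and $(a,b+1,c)$. Vanishing
    therefore spreads over a set [S] closed under both steps, except where the Dunkl number of the
    step is 0. *)
Lemma Mn_vanish (S : nat -> nat -> Prop) v :
  (forall a b, S a b -> S a.+1 b \/ br k1 a.+1 = 0) ->
  (forall a b, S a b -> S a b.+1 \/ br k2 b.+1 = 0) ->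
  Mn v -> (forall s a b, (a + b)%N = n -> S a b -> cf s v a b 0 = 0) ->
  forall s a b c, S a b -> cf s v a b c = 0.
Proof.
move=> S1 S2 /Mn_coefP[deg D] v0 s a b c; elim: c s a b => [|c IH] s a b Sab.
  by have [abn|/eqP abn] := eqVneq (a + b)%N n; [apply: v0|apply: deg; rewrite addn0].
have [ltcn|lenc] := ltnP c n; last by apply: deg; lia.
apply: (mulfI (br3_neq0 _ : br k3 c.+1 != 0)) => //; rewrite mulr0 D.
have -> : br k1 a.+1 * cf (~~ s) v a.+1 b c = 0.
  by case: (S1 _ _ Sab) => [/IH -> | ->]; rewrite ?mulr0 ?mul0r.
have -> : br k2 b.+1 * cf (~~ s) v a b.+1 c = 0.
  by case: (S2 _ _ Sab) => [/IH -> | ->]; rewrite ?mulr0 ?mul0r.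
by rewrite !mulr0 addr0.
Qed.

(** The inverse may be that of 0 for $c>n$, but there the coefficient is 0 by degree. *)
Fixpoint ck_coef (u : bool -> nat -> C) c s a b : C :=
  if c is c'.+1 then
    (br k3 c)^-1 * (- sgn s * (br k1 a.+1 * ck_coef u c' (~~ s) a.+1 b)
                    + iC R * (br k2 b.+1 * ck_coef u c' (~~ s) a b.+1))
  else if (a + b == n)%N then u s a else 0.

Lemma ck_coef_deg u c s a b : (a + b + c)%N <> n -> ck_coef u c s a b = 0.
Proof.
elim: c s a b => [|c IH] s a b deg /=; first by rewrite addn0 in deg; case: eqP.
by rewrite !IH ?mulr0 ?addr0 ?mulr0 //; lia.
Qed.

Lemma mcoeff_trunc (E : 'X_{1..3} -> C) k m :
  (\sum_(m' : 'X_{1..3 < k}) E m' *: 'X_[m'])@_m = if (mdeg m < k)%N then E m else 0.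
Proof.
case: ifP => mk; first exact: mcoeff_mpoly.
rewrite raddf_sum big1 // => m' _; rewrite /= mcoeffZ mcoeffX.
by case: eqP mk => [<-|_ _]; rewrite ?bmdeg ?mulr0.
Qed.

Lemma Mn_extend (u : bool -> nat -> C) :
  exists2 v, Mn v & forall s a, (a <= n)%N -> cf s v a (n - a) 0 = u s a.
Proof.
(* Truncation at total degree $n$ loses nothing, since [ck_coef] is 0 in every other degree. *)
pose P s : Pol := \sum_(m : 'X_{1..3 < n.+1})
  ck_coef u (val m i3) s (val m i1) (val m i2) *: 'X_[val m].
have cfE s a b c : cf s (P true, P false) a b c = ck_coef u c s a b.
  rewrite /cf; have -> : (if s then (P true, P false).1 else (P true, P false).2) = P s.
    by case: s.
  rewrite (mcoeff_trunc (fun m => ck_coef u (m i3) s (m i1) (m i2))).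
  rewrite mon3_1 mon3_2 mon3_3 mdeg_mon3; case: ifP => // /negbT; rewrite -leqNgt => ltn.
  by rewrite ck_coef_deg //; lia.
exists (P true, P false); last first.
  by move=> s a lean; rewrite cfE /= subnKC // eqxx.
apply/Mn_coefP; split=> s a b c; rewrite !cfE; first exact: ck_coef_deg.
have [ltcn|lenc] := ltnP c n; first by rewrite /= mulVKf // br3_neq0.
by rewrite !ck_coef_deg ?mulr0 ?addr0 //; lia.
Qed.

(** * The generators on the restriction to $x_3=0$ *)

Definition isgn s : C := iC R * sgn s.

Lemma genX_comp v s :
  (if s then (genX k1 k2 k3 v).1 else (genX k1 k2 k3 v).2)
  = let w p := refl i2 (refl i3 p) in
    let v' := if s then v.2 else v.1 in let v'' := if s then v.1 else v.2 in
    iC R *: ('X_i3 * dunkl k1 k2 k3 i2 (w v') - 'X_i2 * dunkl k1 k2 k3 i3 (w v'))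
    + 2^-1 *: w v'' + cR k2 *: refl i3 v'' + cR k3 *: refl i2 v''.
Proof. by case: s. Qed.

Lemma sig2_scale s (F : Pol) :
  iC R *: (if s then - (iC R *: F) else iC R *: F) = sgn s *: F.
Proof. by case: s; rewrite ?scalerN scalerA iC_sqr ?scaleN1r ?opprK ?scale1r. Qed.

Lemma sig3_scale s (F : Pol) : iC R *: (if s then F else - F) = isgn s *: F.
Proof. by rewrite /isgn /sgn; case: s; rewrite ?scalerN ?mulrN1 ?mulr1 ?scaleNr. Qed.

Lemma genY_comp v s :
  (if s then (genY k1 k2 k3 v).1 else (genY k1 k2 k3 v).2)
  = let w p := refl i1 (refl i3 p) in
    let v' := if s then v.2 else v.1 in let v'' := if s then v.1 else v.2 in
    sgn s *: ('X_i1 * dunkl k1 k2 k3 i3 (w v') - 'X_i3 * dunkl k1 k2 k3 i1 (w v'))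
    + 2^-1 *: w v'' + cR k3 *: refl i1 v'' + cR k1 *: refl i3 v''.
Proof. by cbv zeta; rewrite -sig2_scale; case: s. Qed.

Lemma genZ_comp v s :
  (if s then (genZ k1 k2 k3 v).1 else (genZ k1 k2 k3 v).2)
  = let w p := refl i1 (refl i2 p) in
    let v'' := if s then v.1 else v.2 in
    isgn s *: ('X_i2 * dunkl k1 k2 k3 i1 (w v'') - 'X_i1 * dunkl k1 k2 k3 i2 (w v''))
    + 2^-1 *: w v'' + cR k1 *: refl i2 v'' + cR k2 *: refl i1 v''.
Proof. by cbv zeta; rewrite -sig3_scale; case: s. Qed.

(* A congruence lemma, because rewriting under [dunkl] makes unification unfold it. *)
Lemma mcoeff_gen (x y z t : C) (i j : 'I_3) (p q r r' r'' : Pol)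
    (m : 'X_{1..3}) (A B E F G : C) :
  (if (0 < m i)%N then p@_(m - U_(i)) else 0) = A ->
  (if (0 < m j)%N then q@_(m - U_(j)) else 0) = B ->
  r@_m = E -> r'@_m = F -> r''@_m = G ->
  (x *: ('X_i * p - 'X_j * q) + y *: r + z *: r' + t *: r'')@_m
  = x * (A - B) + y * E + z * F + t * G.
Proof.
by move=> <- <- <- <- <-; rewrite !mcoeffD !mcoeffZ mcoeffB !mcoeff_mulX.
Qed.

Lemma mcoeff_refl2 (i j : 'I_3) (p : Pol) m :
  (refl i (refl j p))@_m = (-1) ^+ m i * ((-1) ^+ m j * p@_m).
Proof. by rewrite mcoeff_refl; congr (_ * _); apply: mcoeff_refl. Qed.

Lemma mcoeff_dunkl_refl2 (l i j : 'I_3) (p : Pol) m :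
  (dunkl k1 k2 k3 l (refl i (refl j p)))@_m
  = br (kof k1 k2 k3 l) (m l).+1 *
    ((-1) ^+ (m + U_(l))%MM i * ((-1) ^+ (m + U_(l))%MM j * p@_(m + U_(l)))).
Proof. by rewrite mcoeff_dunkl; congr (_ * _); apply: mcoeff_refl2. Qed.

(** At $x_3=0$ the term $x_3T_2$ drops out, and $T_3$ reads the part of $x_3$-degree one, which the
    Dirac equation expresses by degree zero in the opposite component. Together with $\sigma_1$ this
    returns to the component [s]. *)
Lemma genX_coef v s a b : Mn v ->
  cf s (genX k1 k2 k3 v) a b 0
  = (-1) ^+ b * (b%:R + cR k2 + cR k3 + 1 / 2) * cf s v a b 0
    - isgn s * (-1) ^+ b * br k1 a.+1 * (if b is b'.+1 then cf s v a.+1 b' 0 else 0).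
Proof.
move=> /Mn_coefP[_ D]; rewrite {1}/cf genX_comp; cbv zeta.
pose B b : C := if b is b'.+1 then - (-1) ^+ b' * (br k3 1 * cf (~~ s) v a b' 1) else 0.
apply: etrans (mcoeff_gen (A := 0) (B := B b) _ _ _ _ _ _ (mcoeff_refl2 _ _ _ _)
  (mcoeff_refl _ _ _) (mcoeff_refl _ _ _)) _.
- by rewrite mon3_3.
- rewrite mon3_2 /B; case: b => [|b] //=; rewrite mon3B2.
  apply: etrans (mcoeff_dunkl_refl2 _ _ _ _ _) _; rewrite mon3S3 mon3_3 mon3_2.
  by rewrite expr1 /cf; case: (s); rewrite /=; ring.
rewrite mon3_2 mon3_3 -/(cf s v a b 0) /B; case: b => [|b].
  by rewrite /br; field.
rewrite D /br !exprS; case: (signr_cases C b) => -[_ ->];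
  by rewrite /isgn negbK /sgn; case: (s) => /=; field: iC_sqr.
Qed.

Lemma genY_coef v s a b : Mn v ->
  cf s (genY k1 k2 k3 v) a b 0
  = (-1) ^+ a * (a%:R + cR k1 + cR k3 + 1 / 2) * cf s v a b 0
    + isgn s * (-1) ^+ a * br k2 b.+1 * (if a is a'.+1 then cf s v a' b.+1 0 else 0).
Proof.
move=> /Mn_coefP[_ D]; rewrite {1}/cf genY_comp; cbv zeta.
pose A a : C := if a is a'.+1 then - (-1) ^+ a' * (br k3 1 * cf (~~ s) v a' b 1) else 0.
apply: etrans (mcoeff_gen (A := A a) (B := 0) _ _ _ _ _ _ (mcoeff_refl2 _ _ _ _)
  (mcoeff_refl _ _ _) (mcoeff_refl _ _ _)) _.
- rewrite mon3_1 /A; case: a => [|a] //=; rewrite mon3B1.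
  apply: etrans (mcoeff_dunkl_refl2 _ _ _ _ _) _; rewrite mon3S3 mon3_3 mon3_1.
  by rewrite expr1 /cf; case: (s); rewrite /=; ring.
- by rewrite mon3_3.
rewrite mon3_1 mon3_3 -/(cf s v a b 0) /A; case: a => [|a].
  by rewrite /br; field.
rewrite D /br !exprS; case: (signr_cases C a) => -[_ ->];
  by rewrite /isgn negbK /sgn; case: (s) => /=; field.
Qed.

(** $Z$ involves neither $T_3$ nor $x_3$, and $\sigma_3$ is diagonal, so the coefficients are read
    off directly. *)
Lemma genZ_coef v s a b :
  cf s (genZ k1 k2 k3 v) a b 0
  = ((-1) ^+ a * (-1) ^+ b / 2 + cR k1 * (-1) ^+ b + cR k2 * (-1) ^+ a) * cf s v a b 0
    + isgn s * ((-1) ^+ a * (-1) ^+ b)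
      * (br k1 a.+1 * (if b is b'.+1 then cf s v a.+1 b' 0 else 0)
         - br k2 b.+1 * (if a is a'.+1 then cf s v a' b.+1 0 else 0)).
Proof.
rewrite {1}/cf genZ_comp; cbv zeta.
pose A b : C := (-1) ^+ a * (-1) ^+ b
  * (br k1 a.+1 * (if b is b'.+1 then cf s v a.+1 b' 0 else 0)).
pose B a : C := (-1) ^+ a * (-1) ^+ b
  * (br k2 b.+1 * (if a is a'.+1 then cf s v a' b.+1 0 else 0)).
apply: etrans (mcoeff_gen (A := A b) (B := B a) _ _ _ _ _ _ (mcoeff_refl2 _ _ _ _)
  (mcoeff_refl _ _ _) (mcoeff_refl _ _ _)) _.
- rewrite mon3_2 /A; case: b {A B} => [|b] /=; first by rewrite !mulr0.
  rewrite mon3B2; apply: etrans (mcoeff_dunkl_refl2 _ _ _ _ _) _.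
  by rewrite mon3S1 !mon3_1 mon3_2 !exprS -/(cf s v _ _ _) [kof _ _ _ _]/=; ring.
- rewrite mon3_1 /B; case: a {A B} => [|a] /=; first by rewrite !mulr0.
  rewrite mon3B1; apply: etrans (mcoeff_dunkl_refl2 _ _ _ _ _) _.
  by rewrite mon3S2 !mon3_2 mon3_1 !exprS -/(cf s v _ _ _) [kof _ _ _ _]/=; ring.
by rewrite mon3_1 mon3_2 -/(cf s v a b 0) /A /B; field.
Qed.
End DiracKernel.

(** * Subquotients *)

Section Chains.
Variable R : realType.
Local Notation C := (R[i]).

Section ChainCoordinates.
Variables (a b c : C) (d : nat) (h l u : nat -> C).
Hypothesis d_even : ~~ odd d.
Hypothesis l_neq0 : forall i, (i < d)%N -> l i.+1 != 0.
Hypothesis ulE : forall i, (i < d)%N -> u i * l i.+1 = Ophi a b c d i.+1.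
Hypothesis u_max : u d * h d.+1 = 0.

(* [h] lists the coordinates along a chain of monomials on which one of [X], [Y] has
   off-diagonal coefficients [l] and the other one [u]; dividing by [scale_coef]
   normalises the former to 1, as in [O_d]. *)
Definition scale_coef i : C := \prod_(0 <= j < i) l j.+1.

Lemma scale_coefS i : scale_coef i.+1 = scale_coef i * l i.+1.
Proof. exact: big_nat_recr. Qed.

Lemma scale_coef_neq0 i : (i <= d)%N -> scale_coef i != 0.
Proof.
elim: i => [|i IH] leid; first by rewrite /scale_coef big_geq // oner_eq0.
by rewrite scale_coefS mulf_neq0 ?l_neq0 // IH // ltnW.
Qed.

Let y i := h i / scale_coef i.

Let lowerE i : (i <= d)%N -> prv y i = l i * prv h i / scale_coef i.
Proof.
case: i => [|i] ltid /=; first by rewrite mulr0 mul0r.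
rewrite /y scale_coefS; have := scale_coef_neq0 (ltnW ltid).
by move: (l_neq0 ltid) => l0 c0; field; rewrite l0 c0.
Qed.

Let upperE i : (i <= d)%N -> Ophi a b c d i.+1 * y i.+1 = u i * h i.+1 / scale_coef i.
Proof.
rewrite leq_eqVlt => /orP[/eqP ->|ltid]; first by rewrite Ophi_max // u_max !mul0r.
rewrite -ulE // /y scale_coefS; have := scale_coef_neq0 (ltnW ltid).
by move: (l_neq0 ltid) => l0 c0; field; rewrite l0 c0.
Qed.

Lemma OX_chain : OX a d *m cvec d y
  = cvec d (fun i => (Otheta a d i * h i + l i * prv h i) / scale_coef i).
Proof.
rewrite OX_cvec; apply: eq_cvec => i leid.
by rewrite lowerE // /y; ring.
Qed.

(** At $i=d$ the coordinate [h d.+1] lies outside the chain. The condition [u_max] cuts it off,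
    either because a Dunkl number vanishes (the quotients) or because the coordinate does (the
    intersection). *)
Lemma OY_chain : OY a b c d *m cvec d y
  = cvec d (fun i => (Otheta b d i * h i + u i * h i.+1) / scale_coef i).
Proof.
rewrite OY_cvec //; apply: eq_cvec => i leid.
by rewrite upperE // /y; ring.
Qed.

Lemma OZ_chain : Omod d a b c i3 *m cvec d y
  = cvec d (fun i => (Ozeta c d i * h i + (-1) ^+ i * (l i * prv h i)
                      - (-1) ^+ i * (u i * h i.+1)) / scale_coef i).
Proof.
rewrite OZ_cvec //; apply: eq_cvec => i leid.
by rewrite lowerE // -[_ * _ * y _]mulrA upperE // /y; ring.
Qed.
End ChainCoordinates.

(** * Zeros of the Dunkl numbers *)

Lemma br_root (k : R) (t : nat) : odd t -> 2 * k = - t%:R -> br k t = 0.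
Proof.
move=> t_odd kE; rewrite /br -signr_odd t_odd expr1.
have -> : cR k * (1 - -1) = cR (2 * k) by rewrite /cR rmorphM rmorph_nat; ring.
by rewrite kE /cR rmorphN rmorph_nat subrr.
Qed.

Lemma tfun_spec (k : R) t : tfun k = Some t -> odd t /\ 2 * k = - t%:R.
Proof.
rewrite /tfun; case: excluded_middle_informative => // H [<-].
by case: (proj2_sig (constructive_indefinite_description _ H)).
Qed.

Lemma tfun_exists (k : R) m : odd m -> 2 * k = - m%:R -> tfun k = Some m.
Proof.
move=> m_odd kE; case tE : (tfun k) => [t|].
  (* The number picked by description is determined by $2k=-m$. *)
  have [_ kE'] := tfun_spec tE; congr Some; apply/eqP.
  by rewrite -(eqr_nat R) -eqr_opp -kE' kE.
by move: tE; rewrite /tfun; case: excluded_middle_informative => // -[]; exists m.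
Qed.

(** For even $j$ the value is $j\neq0$, so a zero gives $j+2k=0$ with $j$ odd. *)
Lemma br_eq0 (k : R) j : (0 < j)%N -> br k j = 0 -> tfun k = Some j.
Proof.
move=> j_gt0 brk0; have [j_odd|j_even] := boolP (odd j); last first.
  move: brk0; rewrite /br -signr_odd (negbTE j_even) expr0 subrr mulr0 addr0.
  by move/eqP; rewrite pnatr_eq0; case: (j) j_gt0.
apply: tfun_exists => //; apply: (fmorph_inj (real_complex R)).
rewrite rmorphN rmorphM !rmorph_nat /=; apply/eqP; rewrite -addr_eq0 -brk0.
by rewrite /br -signr_odd j_odd expr1 /cR; apply/eqP; ring.
Qed.

Lemma br_neq0 (k : R) t j : tfun k = Some t -> (t < j)%N -> br k j != 0.
Proof.
move=> tE lttj; apply/eqP => /(br_eq0 (leq_ltn_trans (leq0n t) lttj)).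
by rewrite tE => -[tj]; rewrite tj ltnn in lttj.
Qed.

Section Subquotients.
Variables (k1 k2 k3 : R) (n t1 t2 : nat).
Hypothesis n_even : ~~ odd n.
Hypotheses (t1E : tfun k1 = Some t1) (t2E : tfun k2 = Some t2).
Hypothesis t12_le : (t1 + t2 <= n)%N.
Hypothesis br3_neq0 : forall j, (0 < j <= n)%N -> br k3 j != 0.
Local Notation M := (Mn k1 k2 k3 n).
Local Notation act := (BIact k1 k2 k3).

(* The values on the monomials [x_1^a x_2^(n-a)]: an element of [M] is determined by
   its restriction to [x_3 = 0], which can be prescribed arbitrarily. *)
Definition ic s (v : V R) a : C := cf s v a (n - a) 0.

(** All the submodules of the theorem take this form: [S] holds the exponents of $x_1$ at which the
    restriction to $x_3=0$ may be nonzero. *)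
Definition supported (S : pred nat) (v : V R) : Prop :=
  M v /\ forall s a, (a <= n)%N -> ~~ S a -> ic s v a = 0.

Let br1_0 : br k1 t1 = 0. Proof. by have [] := tfun_spec t1E; apply: br_root. Qed.
Let br2_0 : br k2 t2 = 0. Proof. by have [] := tfun_spec t2E; apply: br_root. Qed.

Lemma ic_lin x u v s a : ic s (x *: u + v) a = x * ic s u a + ic s v a.
Proof. by rewrite /ic /cf; case: s; rewrite /= mcoeffD mcoeffZ. Qed.

Lemma mem_msupp_cf (v : V R) m :
  (m \in msupp v.1) || (m \in msupp v.2)
  = (cf true v (m i1) (m i2) (m i3) != 0) || (cf false v (m i1) (m i2) (m i3) != 0).
Proof. by rewrite /cf -mon3_eta !mcoeff_msupp. Qed.

Lemma supported_vanish (S : pred nat) (T : nat -> nat -> Prop) v :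
  (forall a b, T a b -> T a.+1 b \/ br k1 a.+1 = 0) ->
  (forall a b, T a b -> T a b.+1 \/ br k2 b.+1 = 0) ->
  (forall a, (a <= n)%N -> T a (n - a)%N -> ~~ S a) ->
  supported S v -> forall s a b c, T a b -> cf s v a b c = 0.
Proof.
move=> T1 T2 TS [Mv v0]; apply: (Mn_vanish br3_neq0 T1 T2 Mv) => s a b ab Tab.
have bE : (n - a)%N = b by rewrite -ab addKn.
have lean : (a <= n)%N by rewrite -ab leq_addr.
by rewrite -bE; apply: (v0 s a lean); apply: TS; rewrite ?bE.
Qed.

Lemma Mnx_coefP i t v : tfun (kof k1 k2 k3 i) = Some t ->
  Mnx k1 k2 k3 n i v <-> M v /\ forall s a b c, (mon3 a b c i < t)%N -> cf s v a b c = 0.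
Proof.
rewrite /Mnx => ->; split=> -[Mv hv]; split=> //.
  move=> s a b c; rewrite ltnNge => nle; apply/eqP; apply: contraNT nle => nz.
  apply: hv; rewrite mem_msupp_cf mon3_1 mon3_2 mon3_3.
  by move: nz; case: (s) => ->; rewrite ?orbT.
move=> m; apply: contraTT; rewrite -ltnNge (mon3_eta m) => ltmt.
by rewrite mem_msupp_cf mon3_1 mon3_2 mon3_3 !hv ?eqxx.
Qed.

(** Vanishing for $a<t_1$ at $x_3=0$ spreads to all coefficients with $a<t_1$, since the step from
    $t_1-1$ to $t_1$ is blocked by [br k1 t1 = 0]. *)
Lemma Mnx1P v : Mnx k1 k2 k3 n i1 v <-> supported (fun a => t1 <= a)%N v.
Proof.
apply: iff_trans (Mnx_coefP v (t1E : tfun (kof k1 k2 k3 i1) = _)) _.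
split=> [[Mv hv]|Sv]; split=> //; try by case: Sv.
  by move=> s a _; rewrite -ltnNge => lta; apply: hv; rewrite mon3_1.
move=> s a b c; rewrite mon3_1 => lta.
apply: (@supported_vanish _ (fun a _ => a < t1)%N v _ _ _ Sv s a b c lta).
- by move=> e _; rewrite leq_eqVlt => /orP[/eqP ->|]; [right|left].
- by move=> *; left.
- by move=> e _; rewrite -ltnNge.
Qed.

Lemma Mnx2P v : Mnx k1 k2 k3 n i2 v <-> supported (fun a => t2 <= n - a)%N v.
Proof.
apply: iff_trans (Mnx_coefP v (t2E : tfun (kof k1 k2 k3 i2) = _)) _.
split=> [[Mv hv]|Sv]; split=> //; try by case: Sv.
  by move=> s a _; rewrite -ltnNge => lta; apply: hv; rewrite mon3_2.
move=> s a b c; rewrite mon3_2 => ltb.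
apply: (@supported_vanish _ (fun _ b => b < t2)%N v _ _ _ Sv s a b c ltb).
- by move=> *; left.
- by move=> _ e; rewrite leq_eqVlt => /orP[/eqP ->|]; [right|left].
- by move=> e _; rewrite -ltnNge.
Qed.

Lemma Mnx12P v : Mnx k1 k2 k3 n i1 v /\ Mnx k1 k2 k3 n i2 v
  <-> supported (fun a => (t1 <= a) && (t2 <= n - a))%N v.
Proof.
split=> [[/Mnx1P[Mv h1] /Mnx2P[_ h2]]|[Mv h]].
  by split=> // s a lean; rewrite negb_and => /orP[]; [apply: h1|apply: h2].
by split; [apply/Mnx1P|apply/Mnx2P]; split=> // s a lean /negbTE nS; apply: h;
   rewrite // nS ?andbF.
Qed.

Lemma supported_predT v : M v <-> supported predT v.
Proof. by split=> [Mv|[]]. Qed.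

Lemma supported_pred0 v : v = 0 <-> supported pred0 v.
Proof.
split=> [->|Sv].
  split; last by move=> s a _ _; rewrite /ic /cf; case: s; rewrite mcoeff0.
  by apply/Mn_coefP; split=> s a b c *; rewrite /cf; case: s; rewrite /= !mcoeff0 ?mulr0 ?addr0.
have v0 s a b c : cf s v a b c = 0.
  by apply: (@supported_vanish _ (fun _ _ => True) v _ _ _ Sv s a b c I) => //; left.
case: v v0 {Sv} => p q v0; congr pair; apply: mpoly3_eq0 => a b c.
  exact: (v0 true).
exact: (v0 false).
Qed.

Lemma ic_out s v : M v -> ic s v n.+1 = 0.
Proof. by move=> /Mn_coefP[deg _]; apply: deg; lia. Qed.

Let signB a : (a <= n)%N -> (-1) ^+ (n - a) = (-1) ^+ a :> C.
Proof. by move=> lean; rewrite -signr_odd oddB // (negbTE n_even) signr_odd. Qed.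

Lemma ic_succ s v a : M v -> (a <= n)%N ->
  (if (n - a)%N is b'.+1 then cf s v a.+1 b' 0 else 0) = ic s v a.+1.
Proof.
move=> Mv lean; case nE : (n - a)%N => [|b].
  by have -> : a = n by [lia]; rewrite ic_out.
by rewrite /ic subnS nE.
Qed.

Lemma ic_prv s v a : (a <= n)%N ->
  (if a is a'.+1 then cf s v a' (n - a).+1 0 else 0) = prv (ic s v) a.
Proof. by case: a => // a ltan; rewrite /= /ic subnSK. Qed.

Lemma ic_X s v a : M v -> (a <= n)%N -> ic s (genX k1 k2 k3 v) a
  = (-1) ^+ a * ((n - a)%:R + cR k2 + cR k3 + 1 / 2) * ic s v a
    - isgn R s * (-1) ^+ a * br k1 a.+1 * ic s v a.+1.
Proof.
by move=> Mv lean; rewrite {1}/ic (genX_coef s a (n - a) Mv) ic_succ // signB.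
Qed.

Lemma ic_Y s v a : M v -> (a <= n)%N -> ic s (genY k1 k2 k3 v) a
  = (-1) ^+ a * (a%:R + cR k1 + cR k3 + 1 / 2) * ic s v a
    + isgn R s * (-1) ^+ a * br k2 (n - a).+1 * prv (ic s v) a.
Proof.
by move=> Mv lean; rewrite {1}/ic (genY_coef s a (n - a) Mv) ic_prv.
Qed.

Lemma ic_Z s v a : M v -> (a <= n)%N -> ic s (genZ k1 k2 k3 v) a
  = (1 / 2 + (-1) ^+ a * (cR k1 + cR k2)) * ic s v a
    + isgn R s * (br k1 a.+1 * ic s v a.+1 - br k2 (n - a).+1 * prv (ic s v) a).
Proof.
move=> Mv lean; apply: etrans (genZ_coef k1 k2 k3 v s a (n - a)) _.
rewrite (ic_succ s Mv lean) (ic_prv s v lean) (signB lean) -[cf s v _ _ _]/(ic s v a).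
by case: (signr_cases C a) => -[_ ->]; field.
Qed.

Lemma dsum_mul m (W : bimod R m) g (x y : 'cV[C]_m) :
  dsum W W g *m col_mx x y = col_mx (W g *m x) (W g *m y).
Proof. by rewrite /dsum mul_block_col !mul0mx addr0 add0r. Qed.

(** [idx] lists the exponents in [SB] outside [SA], with inverse [jdx]. The isomorphism reads the
    rescaled coordinates there, each component of $\mathbb C^2$ giving one copy of [W]. *)
Lemma subquot_chain d (W : bimod R d.+1) (B A : V R -> Prop) (SB SA : pred nat)
    (idx jdx : nat -> nat) (l : bool -> nat -> C) :
  (forall v, B v <-> supported SB v) -> (forall v, A v <-> supported SA v) ->
  (forall i, (i <= d)%N ->
     [/\ (idx i <= n)%N, SB (idx i), ~~ SA (idx i) & jdx (idx i) = i]) ->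
  (forall a, (a <= n)%N -> SB a -> ~~ SA a -> (jdx a <= d)%N /\ idx (jdx a) = a) ->
  (forall s i, (i < d)%N -> l s i.+1 != 0) ->
  (forall s g v, B v ->
     cvec d (fun i => ic s (act g v) (idx i) / scale_coef (l s) i)
     = W g *m cvec d (fun i => ic s v (idx i) / scale_coef (l s) i)) ->
  subquot_iso act B A (dsum W W).
Proof.
move=> hB hA hidx hjdx l_neq0 hW.
pose phi s v := cvec d (fun i => ic s v (idx i) / scale_coef (l s) i).
have c_neq0 s i : (i <= d)%N -> scale_coef (l s) i != 0.
  by apply: scale_coef_neq0; apply: l_neq0.
exists (fun v => col_mx (phi true v) (phi false v)); split.
- move=> x u v _ _; rewrite scale_col_mx add_col_mx /phi !cvecZ !cvecD.
  by congr col_mx; apply: eq_cvec => i _; rewrite ic_lin mulrDl mulrA.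
- move=> v Bv; have [Mv v0] := (hB v).1 Bv; split; last first.
    move=> /hA[_ vA]; rewrite -[RHS]col_mx0; congr col_mx;
      apply/colP=> i; rewrite !mxE; have [lei _ nSA _] := hidx i (ltn_ord i);
      by rewrite vA // mul0r.
  rewrite -[X in _ = X]col_mx0 => /eq_col_mx[p1 p2]; apply/hA; split=> // s a lean nSA.
  have [Sa|/v0] := boolP (SB a); last exact.
  have [led ia] := hjdx a lean Sa nSA.
  have phi0 : phi s v = 0 by case: s.
  have := congr1 (fun w : 'cV_d.+1 => w (inord (jdx a)) 0) phi0.
  rewrite !mxE inordK // ia => /eqP; rewrite mulf_eq0 invr_eq0 (negbTE (c_neq0 _ _ _)) //.
  by rewrite orbF => /eqP.
- move=> w; pose wc s := if s then usubmx w else dsubmx w.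
  (* A preimage is the extension of the restriction that has the prescribed coordinates on the chain
     and 0 elsewhere. *)
  pose u s a := if SB a && ~~ SA a
    then scale_coef (l s) (jdx a) * wc s (inord (jdx a)) 0 else 0.
  have [v Mv vu] := Mn_extend k1 k2 br3_neq0 u; exists v.
    apply/hB; split=> // s a lean /negbTE nSB.
    by rewrite /ic vu // /u nSB.
  have phiE s : phi s v = wc s.
    rewrite [RHS]cvec_surj; apply: eq_cvec => i leid.
    have [len Si nSi ji] := hidx i leid.
    by rewrite /ic vu // /u Si nSi /= ji mulrC mulKf // c_neq0.
  by rewrite !phiE vsubmxK.
- by move=> g v Bv; rewrite dsum_mul /phi !hW.
Qed.

Let K : C := cR (k1 + k2 + k3).
Let N : C := n.+1%:R / 2.

Lemma isgn_sqr s : isgn R s * isgn R s = -1.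
Proof. by rewrite /isgn mulrACA iC_sqr; case: s; rewrite /sgn; ring. Qed.

Lemma isgn_neq0 s : isgn R s != 0.
Proof.
apply: contraTneq isT => s0; have /eqP := isgn_sqr s.
by rewrite s0 mul0r eq_sym oppr_eq0 oner_eq0.
Qed.

Lemma cR_odd_half (k : R) t : tfun k = Some t -> cR k = - t%:R / 2 :> C.
Proof.
move=> /tfun_spec[_ kE]; have : 2 * cR k = - t%:R :> C.
  by rewrite -(rmorph_nat (real_complex R) t) -rmorphN /= -kE /cR rmorphM rmorph_nat.
by move=> <-; field.
Qed.

Let k1C : cR k1 = - t1%:R / 2 :> C. Proof. exact: cR_odd_half. Qed.
Let k2C : cR k2 = - t2%:R / 2 :> C. Proof. exact: cR_odd_half. Qed.

Let t1_even : ~~ odd t1.-1.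
Proof. by have [] := tfun_spec t1E; case: (t1). Qed.
Let t2_even : ~~ odd t2.-1.
Proof. by have [] := tfun_spec t2E; case: (t2). Qed.
Let t1S : t1.-1.+1 = t1.
Proof. by have [] := tfun_spec t1E; case: (t1). Qed.
Let t2S : t2.-1.+1 = t2.
Proof. by have [] := tfun_spec t2E; case: (t2). Qed.
Let t1R : t1%:R = t1.-1%:R + 1 :> C.
Proof. by rewrite -{1}t1S -natr1. Qed.
Let t2R : t2%:R = t2.-1%:R + 1 :> C.
Proof. by rewrite -{1}t2S -natr1. Qed.

(** * The three chains of monomials and their parameters *)

Definition l2 s i : C := isgn R s * (-1) ^+ i * br k2 (n - i).+1.
Definition u2 s i : C := isgn R s * (-1) ^+ i * br k1 i.+1.

Lemma l2_neq0 s i : (i < t1.-1)%N -> l2 s i.+1 != 0.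
Proof.
move=> ltid; apply: mulf_neq0; last by apply: (br_neq0 t2E); lia.
by rewrite mulf_neq0 ?isgn_neq0 ?signr_eq0.
Qed.

(** The sign $-1$ of [isgn] squared cancels that of $(-1)^i(-1)^{i+1}$, leaving the product of
    [br k1 i.+1] and [br k2 (n - i)], whose factors are those of $\varphi_{i+1}$. *)
Lemma ul2 s i : (i < t1.-1)%N ->
  u2 s i * l2 s i.+1 = Ophi (cR k3) (- K - n%:R - 1) (- cR k2) t1.-1 i.+1.
Proof.
move=> ltid; rewrite /u2 /l2 subnSK; last by lia.
have -> (x y z t w : C) : x * y * z * (x * t * w) = (x * x) * (y * t * (z * w)) by ring.
rewrite isgn_sqr /br signB; last by lia.
rewrite natrB; last by lia.
rewrite /Ophi /K !cRD k1C t1R !exprS /=.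
by case: (signr_cases C i) => -[-> ->] /=; field.
Qed.

Lemma chain2 s g v : M v ->
  cvec t1.-1 (fun i => ic s (act g v) i / scale_coef (l2 s) i)
  = twist 1 (-1) (tperm i1 i2) (Omod t1.-1 (cR k3) (- K - n%:R - 1) (- cR k2)) g
    *m cvec t1.-1 (fun i => ic s v i / scale_coef (l2 s) i).
Proof.
move=> Mv; have l0 := l2_neq0 s; have ul := ul2 s.
(* The chain stops at $t_1-1$ because [br k1 t1 = 0] removes the coupling to the exponent $t_1$. *)
have umax : u2 s t1.-1 * ic s v t1.-1.+1 = 0 by rewrite /u2 t1S br1_0 mulr0 mul0r.
have lein i : (i <= t1.-1)%N -> (i <= n)%N by lia.
elim/ord3_ind: g; rewrite /twist ?tpermL ?tpermR ?tperm12_3 -scalemxAl.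
- rewrite (OY_chain t1_even l0 ul umax) cvecZ; apply: eq_cvec => i /lein lei.
  rewrite mulrA; congr (_ / _); rewrite [LHS](ic_X s Mv lei) natrB // /sgnaut /=.
  by rewrite /u2 /Otheta /K !cRD k1C t1R; field.
- rewrite (OX_chain (cR k3) _ l0) cvecZ; apply: eq_cvec => i /lein lei.
  rewrite mulrA; congr (_ / _); rewrite [LHS](ic_Y s Mv lei) /sgnaut /=.
  by rewrite /l2 /Otheta k1C t1R; field.
- rewrite (OZ_chain t1_even l0 ul umax) cvecZ; apply: eq_cvec => i /lein lei.
  rewrite mulrA; congr (_ / _); rewrite [LHS](ic_Z s Mv lei) /sgnaut /=.
  rewrite /l2 /u2 /Ozeta k1C t1R.
  by case: (signr_cases C i) => -[_ ->]; field.
Qed.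

Definition l3 s i : C := - isgn R s * (-1) ^+ i * br k1 (n - i).+1.
Definition u3 s i : C := - isgn R s * (-1) ^+ i * br k2 i.+1.

Lemma l3_neq0 s i : (i < t2.-1)%N -> l3 s i.+1 != 0.
Proof.
move=> ltid; apply: mulf_neq0; last by apply: (br_neq0 t1E); lia.
by rewrite mulf_neq0 ?oppr_eq0 ?isgn_neq0 ?signr_eq0.
Qed.

Lemma ul3 s i : (i < t2.-1)%N ->
  u3 s i * l3 s i.+1 = Ophi (cR k3) (- K - n%:R - 1) (- cR k1) t2.-1 i.+1.
Proof.
move=> ltid; rewrite /u3 /l3 subnSK; last by lia.
have -> (x y z t w : C) : - x * y * z * (- x * t * w) = (x * x) * (y * t * (z * w)) by ring.
rewrite isgn_sqr /br signB; last by lia.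
rewrite natrB; last by lia.
rewrite /Ophi /K !cRD k2C t2R !exprS /=.
by case: (signr_cases C i) => -[-> ->] /=; field.
Qed.

(** Position [i] stands for $x_1^{n-i}x_2^i$. In this order $X$ is the lower bidiagonal generator,
    so the twist involves no permutation. *)
Lemma chain3 s g v : M v ->
  cvec t2.-1 (fun i => ic s (act g v) (n - i) / scale_coef (l3 s) i)
  = twist 1 (-1) 1 (Omod t2.-1 (cR k3) (- K - n%:R - 1) (- cR k1)) g
    *m cvec t2.-1 (fun i => ic s v (n - i) / scale_coef (l3 s) i).
Proof.
move=> Mv; have l0 := l3_neq0 s; have ul := ul3 s.
pose h i := ic s v (n - i).
have umax : u3 s t2.-1 * h t2.-1.+1 = 0 by rewrite /u3 t2S br2_0 mulr0 mul0r.
(* As $t_1>0$ the inequality is strict, so that [n - i] has a predecessor. *)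
have lein i : (i <= t2.-1)%N -> (i < n)%N by have := t1S; lia.
have h_prv i : (i < n)%N -> ic s v (n - i).+1 = prv h i.
  by case: i => [|i] lti; [rewrite subn0 ic_out|rewrite subnSK 1?ltnW].
have h_succ i : (i < n)%N -> prv (ic s v) (n - i) = h i.+1.
  by move=> lti; rewrite -subnSK.
elim/ord3_ind: g; rewrite /twist perm1 -scalemxAl -/(h _).
- rewrite (OX_chain (cR k3) h l0) cvecZ; apply: eq_cvec => i /lein lti.
  rewrite mulrA; congr (_ / _); rewrite [LHS](ic_X s Mv (leq_subr _ _)) h_prv //.
  rewrite subKn ?signB 1?ltnW // -/(h i) /sgnaut /=.
  by rewrite /l3 /Otheta k2C t2R; field.
- rewrite (OY_chain (h := h) t2_even l0 ul umax) cvecZ; apply: eq_cvec => i /lein lti.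
  rewrite mulrA; congr (_ / _); rewrite [LHS](ic_Y s Mv (leq_subr _ _)) h_succ //.
  rewrite subKn ?signB 1?ltnW // natrB 1?ltnW // -/(h i) /sgnaut /=.
  by rewrite /u3 /Otheta /K !cRD k2C t2R; field.
- rewrite (OZ_chain (h := h) t2_even l0 ul umax) cvecZ; apply: eq_cvec => i /lein lti.
  rewrite mulrA; congr (_ / _); rewrite [LHS](ic_Z s Mv (leq_subr _ _)) h_prv // h_succ //.
  rewrite subKn ?signB 1?ltnW // -/(h i) /sgnaut /=.
  rewrite /l3 /u3 /Ozeta k2C t2R.
  by case: (signr_cases C i) => -[_ ->]; field.
Qed.

Local Notation d1 := (n - t1 - t2)%N.

Let d1_even : ~~ odd d1.
Proof.
have [t1_odd _] := tfun_spec t1E; have [t2_odd _] := tfun_spec t2E.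
by rewrite -subnDA oddB // oddD t1_odd t2_odd (negbTE n_even).
Qed.

Let d1R : d1%:R = n%:R - t1%:R - t2%:R :> C.
Proof. by rewrite !natrB //; lia. Qed.

(** The chain for $W_1$ starts at the odd exponent $t_1$; the resulting sign change accounts for the
    twist $(-1,1)$ in place of $(1,-1)$. *)
Let sign_t1 i : (-1) ^+ (t1 + i) = - (-1) ^+ i :> C.
Proof.
have [t1_odd _] := tfun_spec t1E.
by rewrite exprD -signr_odd t1_odd expr1 mulN1r.
Qed.

Definition l1 s i : C := isgn R s * (-1) ^+ i * br k2 (n - (t1 + i)).+1.
Definition u1 s i : C := isgn R s * (-1) ^+ i * br k1 (t1 + i).+1.

Lemma l1_neq0 s i : (i < d1)%N -> l1 s i.+1 != 0.
Proof.
move=> ltid; apply: mulf_neq0; last by apply: (br_neq0 t2E); lia.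
by rewrite mulf_neq0 ?isgn_neq0 ?signr_eq0.
Qed.

Lemma ul1 s i : (i < d1)%N -> u1 s i * l1 s i.+1
  = Ophi (cR k2 + cR k3 + N) (- cR k1 - cR k3 - N) (- N) d1 i.+1.
Proof.
move=> ltid; rewrite /u1 /l1 addnS subnSK; last by lia.
have -> (x y z t w : C) : x * y * z * (x * t * w) = (x * x) * (y * t * (z * w)) by ring.
rewrite isgn_sqr /br signB; last by lia.
rewrite !exprS !sign_t1 natrB; last by lia.
rewrite /Ophi /N -[d1.+1%:R]natr1 d1R k1C k2C /=.
by case: (signr_cases C i) => -[-> ->] /=; field.
Qed.

Lemma chain1 s g v : supported (fun a => (t1 <= a) && (t2 <= n - a))%N v ->
  cvec d1 (fun i => ic s (act g v) (t1 + i) / scale_coef (l1 s) i)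
  = twist (-1) 1 (tperm i1 i2)
      (Omod d1 (cR k2 + cR k3 + N) (- cR k1 - cR k3 - N) (- N)) g
    *m cvec d1 (fun i => ic s v (t1 + i) / scale_coef (l1 s) i).
Proof.
move=> [Mv v0]; have l0 := l1_neq0 s; have ul := ul1 s.
pose h i := ic s v (t1 + i).
(* Both ends are cut by vanishing coordinates, at the exponents $n-t_2+1$ here and $t_1-1$ in
   [h_prv]. *)
have umax : u1 s d1 * h d1.+1 = 0.
  by rewrite [h _]v0 ?mulr0 //; have := t2S; lia.
have lein i : (i <= d1)%N -> (t1 + i <= n)%N by lia.
have h_prv i : prv (ic s v) (t1 + i) = prv h i.
  case: i => [|i]; last by rewrite addnS.
  by rewrite addn0 -{1}t1S /= v0 //; have := t1S; lia.
have h_succ i : ic s v (t1 + i).+1 = h i.+1 by rewrite -addnS.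
elim/ord3_ind: g; rewrite /twist ?tpermL ?tpermR ?tperm12_3 -scalemxAl -/(h _).
- rewrite (OY_chain (h := h) d1_even l0 ul umax) cvecZ; apply: eq_cvec => i /lein lei.
  rewrite mulrA; congr (_ / _); rewrite [LHS](ic_X s Mv lei) h_succ sign_t1.
  rewrite -/(h i) natrB // natrD /sgnaut /=.
  by rewrite /u1 /Otheta /N d1R k1C k2C; field.
- rewrite (OX_chain (cR k2 + cR k3 + N) h l0) cvecZ; apply: eq_cvec => i /lein lei.
  rewrite mulrA; congr (_ / _); rewrite [LHS](ic_Y s Mv lei) h_prv sign_t1.
  rewrite -/(h i) natrD /sgnaut /=.
  by rewrite /l1 /Otheta /N d1R k1C k2C; field.
- rewrite (OZ_chain (h := h) d1_even l0 ul umax) cvecZ; apply: eq_cvec => i /lein lei.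
  rewrite mulrA; congr (_ / _); rewrite [LHS](ic_Z s Mv lei) h_prv h_succ sign_t1.
  rewrite -/(h i) /sgnaut /= /l1 /u1 /Ozeta /N d1R k1C k2C.
  by case: (signr_cases C i) => -[_ ->]; field.
Qed.

Lemma subquot_M12 :
  subquot_iso act (fun v => Mnx k1 k2 k3 n i1 v /\ Mnx k1 k2 k3 n i2 v) (fun v => v = 0)
    (dsum (twist (-1) 1 (tperm i1 i2)
            (Omod d1 (cR k2 + cR k3 + N) (- cR k1 - cR k3 - N) (- N)))
          (twist (-1) 1 (tperm i1 i2)
            (Omod d1 (cR k2 + cR k3 + N) (- cR k1 - cR k3 - N) (- N)))).
Proof.
apply: (subquot_chain (idx := addn t1) (jdx := subn^~ t1) (l := l1) Mnx12P supported_pred0).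
- by move=> i leid; split=> //=; lia.
- by move=> a lean /=; lia.
- exact: l1_neq0.
- by move=> s g v /Mnx12P; apply: chain1.
Qed.

Local Notation W2 := (twist 1 (-1) (tperm i1 i2)
  (Omod t1.-1 (cR k3) (- K - n%:R - 1) (- cR k2))).
Local Notation W3 := (twist 1 (-1) 1 (Omod t2.-1 (cR k3) (- K - n%:R - 1) (- cR k1))).

Lemma subquot_M2_M12 : subquot_iso act (Mnx k1 k2 k3 n i2)
  (fun v => Mnx k1 k2 k3 n i1 v /\ Mnx k1 k2 k3 n i2 v) (dsum W2 W2).
Proof.
apply: (subquot_chain (idx := id) (jdx := id) (l := l2) Mnx2P Mnx12P).
- by move=> i leid; have := t1S; split=> //=; lia.
- by move=> a lean /=; have := t1S; lia.
- exact: l2_neq0.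
- by move=> s g v [Mv _]; apply: chain2.
Qed.

Lemma subquot_M_M1 : subquot_iso act M (Mnx k1 k2 k3 n i1) (dsum W2 W2).
Proof.
apply: (subquot_chain (idx := id) (jdx := id) (l := l2) supported_predT Mnx1P).
- by move=> i leid; have := t1S; split=> //=; lia.
- by move=> a lean /=; have := t1S; lia.
- exact: l2_neq0.
- by move=> s g v Mv; apply: chain2.
Qed.

Lemma subquot_M1_M12 : subquot_iso act (Mnx k1 k2 k3 n i1)
  (fun v => Mnx k1 k2 k3 n i1 v /\ Mnx k1 k2 k3 n i2 v) (dsum W3 W3).
Proof.
apply: (subquot_chain (idx := subn n) (jdx := subn n) (l := l3) Mnx1P Mnx12P).
- by move=> i leid; have := t2S; split=> //=; lia.
- by move=> a lean /=; have := t2S; lia.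
- exact: l3_neq0.
- by move=> s g v [Mv _]; apply: chain3.
Qed.

Lemma subquot_M_M2 : subquot_iso act M (Mnx k1 k2 k3 n i2) (dsum W3 W3).
Proof.
apply: (subquot_chain (idx := subn n) (jdx := subn n) (l := l3) supported_predT Mnx2P).
- by move=> i leid; have := t2S; split=> //=; lia.
- by move=> a lean /=; have := t2S; lia.
- exact: l3_neq0.
- by move=> s g v Mv; apply: chain3.
Qed.
End Subquotients.
End Chains.

Theorem theorem8p13 (R : realType) (k1 k2 k3 : R) (n t1 t2 : nat) :
  ~~ odd n ->
  tfun k1 = Some t1 -> tfun k2 = Some t2 ->
  (t1 + t2 <= n)%N ->
  (forall t3, tfun k3 = Some t3 -> (n < t3)%N) ->
  let C := R[i] in
  let K : C := cR (k1 + k2 + k3) in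
  let N : C := (n.+1)%:R / 2 in
  let W1 := twist (-1) 1 (tperm i1 i2)
              (Omod (n - t1 - t2) (cR k2 + cR k3 + N) (- cR k1 - cR k3 - N) (- N)) in
  let W2 := twist 1 (-1) (tperm i1 i2)
              (Omod t1.-1 (cR k3) (- K - n%:R - 1) (- cR k2)) in
  let W3 := twist 1 (-1) 1
              (Omod t2.-1 (cR k3) (- K - n%:R - 1) (- cR k1)) in
  let M := Mn k1 k2 k3 n in
  let M1 := Mnx k1 k2 k3 n i1 in
  let M2 := Mnx k1 k2 k3 n i2 in
  let M12 := fun v => M1 v /\ M2 v in
  let act := BIact k1 k2 k3 in
  (* (i) *)
  subquot_iso act M12 (fun v => v = 0) (dsum W1 W1) /\
  (* (ii) *)
  subquot_iso act M2 M12 (dsum W2 W2) /\ subquot_iso act M M1 (dsum W2 W2) /\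
  (* (iii) *)
  subquot_iso act M1 M12 (dsum W3 W3) /\ subquot_iso act M M2 (dsum W3 W3) /\
  (* moreover *)
  (0 <= k3 ->
     [/\ irreducible W1, irreducible W2 & irreducible W3] /\
     [/\ mx_iso W1 (Omod (n - t1 - t2) (- cR k1 - cR k3 - N) (- cR k2 - cR k3 - N) N),
         mx_iso W2 (Omod t1.-1 (K + n%:R + 1) (cR k3) (cR k2))
       & mx_iso W3 (Omod t2.-1 (cR k3) (K + n%:R + 1) (cR k1))]).
Proof.
move=> n_even t1E t2E t12 t3_gt C K N W1 W2 W3 M M1 M2 M12 act.
(* A zero of [br k3] can only be at $t_3>n$. *)
have br3_neq0 j : (0 < j <= n)%N -> br k3 j != 0.
  move=> /andP[j_gt0 lejn]; apply/eqP => /(br_eq0 j_gt0) /t3_gt.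
  by rewrite ltnNge lejn.
split; first exact: (subquot_M12 n_even t1E t2E t12 br3_neq0).
split; first exact: (subquot_M2_M12 n_even t1E t2E t12 br3_neq0).
split; first exact: (subquot_M_M1 n_even t1E t2E t12 br3_neq0).
split; first exact: (subquot_M1_M12 n_even t1E t2E t12 br3_neq0).
split; first exact: (subquot_M_M2 n_even t1E t2E t12 br3_neq0).
move=> k3_ge0.
have [t1_odd _] := tfun_spec t1E; have [t2_odd _] := tfun_spec t2E.
have t1S : t1.-1.+1 = t1 by case: (t1) t1_odd.
have t2S : t2.-1.+1 = t2 by case: (t2) t2_odd.
have p_even : ~~ odd t1.-1 by move: t1_odd; rewrite -t1S.
have q_even : ~~ odd t2.-1 by move: t2_odd; rewrite -t2S.
have d_even : ~~ odd (n - t1 - t2).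
  by rewrite -subnDA oddB // oddD t1_odd t2_odd (negbTE n_even).
have k1E : 2 * cR k1 = - t1.-1.+1%:R :> C.
  by rewrite t1S (cR_odd_half t1E); field.
have k2E : 2 * cR k2 = - t2.-1.+1%:R :> C.
  by rewrite t2S (cR_odd_half t2E); field.
have nE : (n - t1 - t2 + t1.-1.+1 + t2.-1.+1)%N = n by rewrite t1S t2S; lia.
have nE' : (n - t1 - t2 + t2.-1.+1 + t1.-1.+1)%N = n by rewrite t1S t2S; lia.
have m1_neq0 : (-1 : C) != 0 by rewrite oppr_eq0 oner_eq0.
have irr1 := O1_irreducible d_even k1E k2E k3_ge0.
have irr2 := O2_irreducible (n - t1 - t2) p_even k1E k2E k3_ge0.
(* The module underlying $W_3$ is the one underlying $W_2$ with the indices 1 and 2 exchanged. *)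
have irr3 := O2_irreducible (n - t1 - t2) q_even k2E k1E k3_ge0.
have iso1 := O1_iso d_even k1E k2E k3_ge0.
have iso2 := O2_iso (n - t1 - t2) p_even k1E k2E k3_ge0.
have iso3 := O3_iso (n - t1 - t2) q_even k2E k1E k3_ge0.
rewrite nE in irr1 irr2 iso1 iso2; rewrite nE' [k2 + k1]addrC in irr3 iso3.
by split; split=> //; apply: irreducible_twist; rewrite ?oner_eq0.
Qed.
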